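(* Let $\psi\in C^1(\mathbb{R}^2,\mathbb{R}^2)$, let $\phi\in C(\mathbb{R}\times\mathbb{R}^2\times[0,1],\mathbb{R}^2)$ be $T$-periodic in its first variable, and assume that $\dot x=\psi(x)$ has a limit cycle $x_0$ of smallest period $T>0$ such that the linearized system $\dot y=\psi'(x_0(t))y$ has only one characteristic multiplier equal to $1$. Assume that there is $\theta_0\in[0,T]$ such that, for all sufficiently small $\varepsilon>0$, the system $$\dot x=\psi(x)+\varepsilon\phi(t,x,\varepsilon)$$ has a $T$-periodic solution $x_\varepsilon$ satisfying $x_\varepsilon(t-\theta_0)\to x_0(t)$ as $\varepsilon\to0$ for any $t\in[0,T]$. Then there exist constants $0<M_1<M_2$, $\varepsilon_0>0$, $r_0\in(0,1]$ and functions $\theta_\varepsilon:[0,T]\to\mathbb{R}$, $\varepsilon\in(0,\varepsilon_0)$, such that $$\varepsilon M_1|f_1(\theta_0,t)|\le\left\|x_\varepsilon(t-\theta_\varepsilon(t))-x_0(t)\right\|+o(\varepsilon)\le\varepsilon M_2|f_1(\theta_0,t)|\quad\text{for any }\varepsilon\in(0,\varepsilon_0)\text{ and any }t\in[0,T],$$ where $\theta_\varepsilon(t)\to\theta_0$ as $\varepsilon\to0$ uniformly with respect to $t\in[0,T]$, and $x_\varepsilon(t-\theta_\varepsilon(t))\in I(t,[-r_0,r_0])$ for all $t\in[0,T]$ and $\varepsilon\in(0,\varepsilon_0)$.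
   Context: An eigenfunction of a linear $T$-periodic system corresponding to a characteristic multiplier $\rho$ is a nontrivial solution $y$ with $y(t+T)=\rho\,y(t)$. ''Only one characteristic multiplier equal to $1$'' means that $1$ is a simple multiplier, so the other multiplier differs from $1$. The functions $z_0$ and $z_1$ are eigenfunctions of the adjoint system $\dot z=-(\psi'(x_0(t)))^*z$ ($*$ = transpose) corresponding to the characteristic multipliers $1$ and $\rho_*\neq1$ respectively. Define $$f_1(\theta,s)=\int_{s-T}^s\langle z_1(\tau),\phi(\tau-\theta,x_0(\tau),0)\rangle\,d\tau .$$ For $a\in\mathbb{R}^2$, $a^\bot$ is $a$ rotated clockwise by $\pi/2$. $\Omega(\cdot,t_0,\xi)$ is the solution of $\dot x=\psi(x)$ with $x(t_0)=\xi$. For $t,r\in\mathbb{R}$ put $$h(t,r)=x_0(t)+r\,\frac{z_0(t)^\bot}{\|z_0(t)^\bot\|},\qquad I(t,r)=\Omega(T,0,h(t,r)),$$ (wherever the solution exists on $[0,T]$), and $I(t,[-r_0,r_0])=\{I(t,r):r\in[-r_0,r_0]\}$. The symbol $o(\varepsilon)$ denotes a real-valued function of $\varepsilon$ (possibly depending also on $t$) with $o(\varepsilon)/\varepsilon\to0$ as $\varepsilon\to0$ uniformly in $t\in[0,T]$. *)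

(* Defs.v *)
From HB Require Import structures.
From mathcomp Require Import all_boot all_order all_algebra.
From mathcomp Require Import all_classical all_reals all_analysis.

Set Implicit Arguments.
Unset Strict Implicit.
Unset Printing Implicit Defensive.
Import Order.TTheory GRing.Theory Num.Theory numFieldNormedType.Exports.

Local Open Scope classical_set_scope.
Local Open Scope ring_scope.

(* Vectors are rows: the derivative of psi at p acts by [v *m jacobian psi p],
   so [jacobian psi p] is the transpose of the usual column-convention Jacobian
   matrix psi'(p), and the linear system y' = psi'(x0(t)) y reads
   y' = y *m jacobian psi (x0 t). *)

(* The library norm on 'rV[R]_2 is the max norm, hence a separate Euclidean
   norm. *)
Definition dot (R : realType) (u v : 'rV[R]_2) : R := \sum_i u 0 i * v 0 i.

Definition enorm (R : realType) (u : 'rV[R]_2) : R := Num.sqrt (dot u u).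

(* (a1, a2) |-> (a2, - a1), the clockwise rotation by pi / 2 *)
Definition perp (R : realType) (a : 'rV[R]_2) : 'rV[R]_2 :=
  \row_(j < 2) (if j == 0 then a 0 1 else - a 0 0).

Definition C1 (R : realType) (psi : 'rV[R]_2 -> 'rV[R]_2) : Prop :=
  (forall p, differentiable psi p) /\ continuous (jacobian psi).

Definition solves_on (R : realType) (D : set R)
    (F : R -> 'rV[R]_2 -> 'rV[R]_2) (x : R -> 'rV[R]_2) : Prop :=
  forall t, D t -> is_derive t (1 : R) x (F t (x t)).

Definition lin (R : realType) (A : R -> 'M[R]_2) : R -> 'rV[R]_2 -> 'rV[R]_2 :=
  fun t y => y *m A t.

Definition linearization (R : realType) (psi : 'rV[R]_2 -> 'rV[R]_2)
    (x0 : R -> 'rV[R]_2) : R -> 'M[R]_2 :=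
  fun t => jacobian psi (x0 t).

Definition adjoint (R : realType) (A : R -> 'M[R]_2) : R -> 'M[R]_2 :=
  fun t => - (A t)^T.

Definition smallest_period (R : realType) (x : R -> 'rV[R]_2) (T : R) : Prop :=
  [/\ 0 < T, periodic x T & forall S, 0 < S -> periodic x S -> T <= S].

(* A limit cycle is a closed orbit that is isolated: no other closed orbit lies
   in a suitable neighbourhood of it. *)
Definition limit_cycle (R : realType) (psi : 'rV[R]_2 -> 'rV[R]_2)
    (x0 : R -> 'rV[R]_2) (T : R) : Prop :=
  [/\ solves_on setT (fun=> psi) x0,
      smallest_period x0 T
    & exists U : set 'rV[R]_2, [/\ open U, range x0 `<=` U &
        forall y S, solves_on setT (fun=> psi) y -> smallest_period y S ->
          range y `<=` U -> range y = range x0]].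

(* Characteristic multipliers, counted with multiplicity, are the eigenvalues
   Y(T) of the fundamental matrix with Y(0) = 1; in the row convention its rows
   are the solutions, Y' = Y *m A. *)
Definition simple_multiplier (R : realType) (A : R -> 'M[R]_2) (T rho : R) :
    Prop :=
  exists Y : R -> 'M[R]_2,
    [/\ Y 0 = 1%:M, (forall t, is_derive t (1 : R) Y (Y t *m A t))
      & mup rho (char_poly (Y T)) = 1%N].

Definition eigenfunction (R : realType) (A : R -> 'M[R]_2) (T rho : R)
    (y : R -> 'rV[R]_2) : Prop :=
  [/\ solves_on setT (lin A) y, (exists t, y t != 0)
    & forall t, y (t + T) = rho *: y t].

Definition f1 (R : realType) (T : R) (phi : R -> 'rV[R]_2 -> R -> 'rV[R]_2)
    (x0 z1 : R -> 'rV[R]_2) (theta s : R) : R :=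
  \int[lebesgue_measure]_(tau in `[s - T, s])
    dot (z1 tau) (phi (tau - theta) (x0 tau) 0).

(* The flow as a partial function: [Omega psi t t0 xi] is the set of values at
   time t of solutions of x' = psi(x), x(t0) = xi living on an open interval
   containing t0 and t. For psi of class C^1 it has at most one element, and it
   is empty when the maximal solution does not reach t. *)
Definition Omega (R : realType) (psi : 'rV[R]_2 -> 'rV[R]_2) (t t0 : R)
    (xi : 'rV[R]_2) : set 'rV[R]_2 :=
  [set p | exists a b x, [/\ t0 \in `]a, b[, t \in `]a, b[,
     solves_on `]a, b[ (fun=> psi) x, x t0 = xi & x t = p]].

Definition hmap (R : realType) (x0 z0 : R -> 'rV[R]_2) (t r : R) : 'rV[R]_2 :=
  x0 t + r *: ((enorm (perp (z0 t)))^-1 *: perp (z0 t)).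

Definition Imap (R : realType) (psi : 'rV[R]_2 -> 'rV[R]_2) (T : R)
    (x0 z0 : R -> 'rV[R]_2) (t r : R) : set 'rV[R]_2 :=
  Omega psi T 0 (hmap x0 z0 t r).

(* Main.v *)
(* Fix t and put D(s) = x_e(s - theta) - x0(s), which is T-periodic.  Pairing the
   equation for D with the adjoint eigenfunction z1 and integrating over
   [t - T, t] gives (1 - 1/rho) <z1(t), D(t)> = e f1(theta0, t) + o(e + |D|).
   The phase theta = theta_e(t) is chosen by the intermediate value theorem so
   that the flow carries x_e(t - theta), in time - T, into the line through
   x0(t) orthogonal to z0(t); pairing with z0 then gives <z0(t), D(t)> = o(|D|).
   As z0(t) and z1(t) are independent, Cramer's rule yields
   |D(t)| = e kappa(t) |f1(theta0, t)| + o(e) with kappa continuous and positive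
   on [0, T].  The backward flow near the cycle is that of psi composed with a
   clamping map onto a large ball, which is globally Lipschitz. *)
Require Import Defs.
From HB Require Import structures.
From mathcomp Require Import all_boot all_order all_algebra.
From mathcomp Require Import all_classical all_reals all_analysis.
From mathcomp Require Import ring lra.
Import Order.TTheory GRing.Theory Num.Theory numFieldNormedType.Exports.
Local Open Scope classical_set_scope.
Local Open Scope ring_scope.

(** Integration over a period leaves the factor 1 - 1/rho in front of <z1, D>; for [z0] the
    corresponding factor is 0, so the component of D along the cycle is free and only the phase can
    control it. The phase condition is imposed on the backward image because the unperturbed flow
    then links it to D(t): along that flow the pairing with [z0] drifts by the linearization error
    alone, with no forcing term. The intermediate value theorem needs <z0, x0'> to be nonzero; this
    constant is the pairing of a left and a right eigenvector of the monodromy matrix for a simple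
    eigenvalue. All comparisons of trajectories reduce to mean value and Gronwall inequalities. The
    function [o] is defined as e kappa |f1| - |D|, which turns the two-sided estimate into bounds
    for kappa on [0, T]. *)

(** * Vectors of the plane in coordinates *)

Lemma dotE (R : realType) (u v : 'rV[R]_2) :
  dot u v = u 0 0 * v 0 0 + u 0 1 * v 0 1.
Proof.
rewrite /dot !big_ord_recl big_ord0 addr0.
by have -> : lift ord0 ord0 = 1 :> 'I_2 by apply/val_inj.
Qed.

Lemma ord2P (i : 'I_2) : i = 0 \/ i = 1.
Proof. by case: i => -[|[|]]//= hi; [left|right]; apply/val_inj. Qed.

Lemma rV2P (R : realType) (u v : 'rV[R]_2) :
  u 0 0 = v 0 0 -> u 0 1 = v 0 1 -> u = v.
Proof. by move=> h0 h1; apply/rowP => i; case: (ord2P i) => ->. Qed.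

Lemma norm_rV2_le (R : realType) (u : 'rV[R]_2) (a : R) :
  (`|u| <= a) = (`|u 0 0| <= a) && (`|u 0 1| <= a).
Proof.
have ha i : `|u 0 i| <= `|u|.
  rewrite [leRHS]/Num.Def.normr/= mx_normrE.
  exact: (le_bigmax _ _ (0 : 'I_1, i)).
apply/idP/andP => [h|[h0 h1]]; first by split; apply: (le_trans (ha _)).
rewrite [leLHS]/Num.Def.normr/= mx_normrE.
apply: bigmax_le; first exact: le_trans h0.
by move=> [i j] _ /=; rewrite ord1; case: (ord2P j) => ->.
Qed.

Lemma coord_le_norm (R : realType) (u : 'rV[R]_2) i : `|u 0 i| <= `|u|.
Proof.
by have := lexx `|u|; rewrite norm_rV2_le => /andP[]; case: (ord2P i) => ->.
Qed.

Lemma is_derive_coord (R : realType) m n (M : R -> 'M[R]_(m, n)) t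
    (dM : 'M[R]_(m, n)) i j :
  is_derive t (1 : R) M dM -> is_derive t (1 : R) (fun s => M s i j) (dM i j).
Proof.
move=> [dMt <-]; split; first by move/derivable_mxP : dMt; exact.
by rewrite derive_mx// mxE.
Qed.

Lemma is_derive_rV2 (R : realType) (u : R -> 'rV[R]_2) t (du : 'rV[R]_2) :
  is_derive t (1 : R) (fun s => u s 0 0) (du 0 0) ->
  is_derive t (1 : R) (fun s => u s 0 1) (du 0 1) ->
  is_derive t (1 : R) u du.
Proof.
move=> [d0 e0] [d1 e1].
have d : derivable u t 1.
  apply: (derivable_mxP u t 1).2 => i j.
  have -> : i = 0 by apply/val_inj; case: i => -[].
  by case: (ord2P j) => ->; [exact: d0|exact: d1].
by split=> //; rewrite derive_mx//; apply: rV2P; rewrite mxE.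
Qed.

Lemma is_derive_dot (R : realType) (u v : R -> 'rV[R]_2) t du dv :
  is_derive t (1 : R) u du -> is_derive t (1 : R) v dv ->
  is_derive t (1 : R) (fun s => dot (u s) (v s)) (dot du (v t) + dot (u t) dv).
Proof.
move=> hu hv; have cu i := is_derive_coord _ _ _ _ _ _ 0 i hu.
have cv i := is_derive_coord _ _ _ _ _ _ 0 i hv.
under eq_fun do rewrite dotE.
have c i := is_deriveM (cu i) (cv i).
by apply: is_derive_eq (is_deriveD (c 0) (c 1)) _; rewrite !dotE /GRing.scale/=; ring.
Qed.

Lemma derive_cont (R : realType) (V : normedModType R) (f : R -> V) t df :
  is_derive t (1 : R) f df -> {for t, continuous f}.
Proof. by move=> [d _]; apply: differentiable_continuous; apply/derivable1_diffP. Qed.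

Lemma dot_le (R : realType) (u v : 'rV[R]_2) : `|dot u v| <= 2 * `|u| * `|v|.
Proof.
rewrite dotE (le_trans (ler_normD _ _))// !normrM.
by rewrite -mulrA mulr_natl mulr2n lerD// ler_pM// coord_le_norm.
Qed.

Lemma dotBr (R : realType) (u v w : 'rV[R]_2) : dot u (v - w) = dot u v - dot u w.
Proof. by rewrite !dotE !mxE; ring. Qed.

Lemma dotZr (R : realType) a (u v : 'rV[R]_2) : dot u (a *: v) = a * dot u v.
Proof. by rewrite !dotE !mxE; ring. Qed.

Lemma dotZl (R : realType) a (u v : 'rV[R]_2) : dot (a *: u) v = a * dot u v.
Proof. by rewrite !dotE !mxE; ring. Qed.

Lemma mulmx2E (R : realType) (u : 'rV[R]_2) (M : 'M[R]_2) i :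
  (u *m M) 0 i = u 0 0 * M 0 i + u 0 1 * M 1 i.
Proof.
rewrite mxE !big_ord_recl big_ord0 addr0.
by have -> : lift ord0 ord0 = 1 :> 'I_2 by apply/val_inj.
Qed.

Lemma dot_adjoint (R : realType) (u v : 'rV[R]_2) (A : 'M[R]_2) :
  dot (u *m - A^T) v = - dot u (v *m A).
Proof. by rewrite !dotE !mulmx2E !mxE; ring. Qed.

Lemma dot_self_le (R : realType) (u : 'rV[R]_2) : `|u| ^+ 2 <= dot u u.
Proof.
have [h|h] : `|u| <= `|u 0 0| \/ `|u| <= `|u 0 1|.
- case: (leP `|u 0 0| `|u 0 1|) => h; [right|left];
  by rewrite norm_rV2_le ?lexx/= ?andbT ?h ?(ltW h).
- rewrite (@le_trans _ _ (`|u 0 0| ^+ 2))// ?lerXn2r ?nnegrE//.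
  by rewrite real_normK ?num_real// dotE -!expr2 lerDl sqr_ge0.
- rewrite (@le_trans _ _ (`|u 0 1| ^+ 2))// ?lerXn2r ?nnegrE//.
  by rewrite real_normK ?num_real// dotE -!expr2 lerDr sqr_ge0.
Qed.

Lemma dot_self_ge (R : realType) (u : 'rV[R]_2) : dot u u <= 2 * `|u| ^+ 2.
Proof.
by rewrite expr2 mulrA (le_trans (ler_norm _)) ?dot_le.
Qed.

Lemma norm_mulmx2_le (R : realType) (u : 'rV[R]_2) (M : 'M[R]_2) (a : R) :
  (forall i j, `|M i j| <= a) -> `|u *m M| <= 2 * a * `|u|.
Proof.
move=> h; have h' i : `|(u *m M) 0 i| <= 2 * a * `|u|.
  rewrite mulmx2E (le_trans (ler_normD _ _))// !normrM.
  rewrite -mulrA mulr_natl mulr2n lerD// mulrC ler_pM// coord_le_norm//.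
by rewrite norm_rV2_le !h'.
Qed.

(** * Mean value and Gronwall inequalities *)

(** Serves two purposes: [k = -1] is time reversal, for backward estimates and the negative
    half-line, and [k = 1] is translation in time. *)
Lemma is_derive_affine (R : realType) (f : R -> R) (k s t df : R) :
  is_derive (k * t + s) 1 f df -> is_derive t 1 (fun t => f (k * t + s)) (k * df).
Proof.
move=> h; have hg : is_derive t 1 (fun t : R => k * t + s) k.
  have := is_deriveD (is_deriveZ k (is_derive_id t (1 : R))) (is_derive_cst s t (1 : R)).
  by move=> H; apply: is_derive_eq H _; rewrite addr0 /GRing.scale/= mulr1.
by rewrite mulrC; exact: (@is_derive1_comp R f (fun t => k * t + s) t df k).
Qed.

Lemma is_derive_rV2_affine (R : realType) (f : R -> 'rV[R]_2) (k s t : R) df :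
  is_derive (k * t + s) 1 f df ->
  is_derive t 1 (fun t => f (k * t + s)) (k *: df).
Proof.
by move=> h; apply: is_derive_rV2; rewrite mxE;
  have := is_derive_coord _ _ _ _ _ _ 0 _ h => c;
  [have := is_derive_affine _ _ _ _ _ _ (c 0)|have := is_derive_affine _ _ _ _ _ _ (c 1)].
Qed.

Lemma is_derive_rV2_shift (R : realType) (f : R -> 'rV[R]_2) (s t : R) df :
  is_derive (t + s) 1 f df -> is_derive t 1 (fun t => f (t + s)) df.
Proof.
move=> h; have := is_derive_rV2_affine _ f 1 s t df; rewrite mul1r scale1r => /(_ h).
by under eq_fun do rewrite mul1r.
Qed.

Lemma mvt_le (R : realType) (f df : R -> R) (a b c : R) : a <= b ->
  (forall t, a <= t <= b -> is_derive t 1 f (df t)) ->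
  (forall t, a < t < b -> df t <= c) -> f b - f a <= c * (b - a).
Proof.
rewrite le_eqVlt => /predU1P[->|ab] fdf dfc; first by rewrite !subrr mulr0.
have [||d] := @MVT R f df a b ab.
- by move=> x; rewrite in_itv/= => /andP[ax xb]; apply: fdf; rewrite !ltW.
- apply: derivable_within_continuous => x; rewrite in_itv/= => xab.
  by have [] := fdf _ xab.
- by rewrite in_itv/= => dab ->; rewrite ler_wpM2r ?dfc// subr_ge0 ltW.
Qed.

Lemma mvt_norm_le (R : realType) (f df : R -> R) (a b c : R) : a <= b ->
  (forall t, a <= t <= b -> is_derive t 1 f (df t)) ->
  (forall t, a < t < b -> `|df t| <= c) -> `|f b - f a| <= c * (b - a).
Proof.
move=> ab fdf dfc; rewrite ler_norml; apply/andP; split; last first.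
  by apply: mvt_le ab fdf _ => t /dfc; rewrite ler_norml => /andP[].
rewrite lerNl opprB.
have -> : f a - f b = (- f) b - (- f) a by rewrite opprK addrC.
apply: (mvt_le _ (- f) (fun t => - df t)) => // t tab.
  by apply: is_deriveN; exact: fdf.
by rewrite lerNl; move/dfc : tab; rewrite ler_norml => /andP[].
Qed.

(** For the max norm the scalar inequality applies to each coordinate and no constant is lost. *)
Lemma mvt_rV2_le (R : realType) (f df : R -> 'rV[R]_2) (a b c : R) : a <= b ->
  (forall t, a <= t <= b -> is_derive t 1 f (df t)) ->
  (forall t, a < t < b -> `|df t| <= c) -> `|f b - f a| <= c * (b - a).
Proof.
move=> ab fdf dfc.
have H i : `|(f b - f a) 0 i| <= c * (b - a).
  rewrite !mxE; apply: (mvt_norm_le _ (fun t => f t 0 i) (fun t => df t 0 i)) => // t tab.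
    exact/is_derive_coord/fdf.
  by apply: le_trans (dfc t tab); apply: coord_le_norm.
by rewrite norm_rV2_le !H.
Qed.

(** The function [p], that is q(t) exp(-K (t - a)) - c t, is nonincreasing: its derivative is at
    most c times the exponential minus c, and the exponential is at most 1 to the right of a. *)
Lemma gronwall_scalar (R : realType) (q dq : R -> R) (K c a b : R) :
  a <= b -> 0 <= K -> 0 <= c ->
  (forall t, a <= t <= b -> is_derive t 1 q (dq t)) ->
  (forall t, a < t < b -> dq t <= K * q t + c) ->
  q b <= expR (K * (b - a)) * (q a + c * (b - a)).
Proof.
move=> ab K0 c0 qdq dqK.
pose p t := q t * expR (- K * t + K * a) - c * t.
pose dp t := (dq t - K * q t) * expR (- K * t + K * a) - c.
have pdp t : a <= t <= b -> is_derive t 1 p (dp t).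
  move=> tab; have h1 := qdq _ tab.
  have h2 := is_derive_affine _ _ _ _ _ _ (is_derive_expR (- K * t + K * a)).
  have h3 := is_deriveZ c (is_derive_id t (1 : R)).
  apply: is_derive_eq (is_deriveB (is_deriveM h1 h2) h3) _.
  by rewrite /dp /GRing.scale/=; ring.
have : p b - p a <= 0 * (b - a).
  apply: mvt_le ab pdp _ => t tab; rewrite /dp subr_le0.
  have e1 : expR (- K * t + K * a) <= 1.
    rewrite -expR0 ler_expR; have : 0 <= K * (t - a); last by lra.
    by case/andP: tab => a_t _; rewrite mulr_ge0// subr_ge0 ltW.
  apply: (@le_trans _ _ (c * expR (- K * t + K * a))).
    by rewrite ler_wpM2r ?expR_ge0// lerBlDl dqK.
  by rewrite ler_piMr.
rewrite mul0r subr_le0 /p.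
have -> : - K * a + K * a = 0 by ring.
have -> : - K * b + K * a = - (K * (b - a)) by ring.
rewrite expR0 mulr1 => h.
rewrite -[leLHS]mulr1 -(expRxMexpNx_1 (K * (b - a))) mulrCA ler_wpM2l ?expR_ge0//.
by move: h; lra.
Qed.

(** The exit time is the infimum of the set where f >= r; continuity puts the infimum in this
    set. *)
Lemma first_exit (R : realType) (f : R -> R) (a b r : R) : a <= b ->
  (forall t, a <= t <= b -> {for t, continuous f}) -> f a < r -> r <= f b ->
  exists c, [/\ a <= c <= b, r <= f c & forall t, a <= t < c -> f t < r].
Proof.
move=> ab cf far rfb.
pose S := [set t | a <= t <= b /\ r <= f t].
have Sb : S b by split=> //; rewrite ab lexx.
have lS : has_lbound S by exists a => t [/andP[]].
have iS : has_inf S by split=> //; exists b.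
have hc : a <= inf S <= b.
  by rewrite lb_le_inf ?(ge_inf lS Sb)//; [exists b|move=> t [/andP[]]].
exists (inf S); split => // [|t /andP[a_t tc]].
  rewrite leNgt; apply/negP => fc.
  have := cf _ hc => /cvgrPdist_lt /(_ (r - f (inf S))).
  rewrite subr_gt0 => /(_ fc) /nbhs_ballP[d /= d0 hd].
  have [s [[/andP[a_s sb] rfs]] sd] := inf_adherent d0 iS.
  have : ball (inf S) d s.
    rewrite /ball/= ltr_norml ltrBrDl ltrBlDr; have := ge_inf lS (conj _ rfs).
    rewrite a_s sb => /(_ isT) h; apply/andP; split; last by lra.
    by lra.
  by move=> /hd; rewrite ltr_norml => /andP[]; lra.
rewrite ltNge; apply/negP => rft.
have : S t by split => //; rewrite a_t/=; case/andP: hc => _; lra.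
by move=> /(ge_inf lS); lra.
Qed.

Lemma norm_cont (R : realType) (D : R -> 'rV[R]_2) (t : R) d :
  is_derive t 1 D d -> {for t, continuous (fun s => `|D s|)}.
Proof. by move=> /derive_cont h; apply: continuous_comp h _; apply: norm_continuous. Qed.

(* If |D'| <= L |D| + eta then q = <D, D> satisfies q' <= (4 L + 2) q + 2 eta^2. *)
Definition gronwall_const (R : realType) (L Delta : R) : R :=
  expR ((4 * L + 2) * Delta) * (2 + 2 * Delta).

Lemma gronwall_const_ge1 (R : realType) (L Delta : R) :
  0 <= L -> 0 <= Delta -> 1 <= gronwall_const R L Delta.
Proof.
move=> L0 D0; rewrite /gronwall_const -[leLHS]mul1r ler_pM//; last by lra.
by rewrite -[leLHS]expR0 ler_expR mulr_ge0//; lra.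
Qed.

(* The differential inequality is only assumed while |D| < r; the conclusion is
   below r, so D cannot exit this range. *)
Lemma gronwall_fwd (R : realType) (L Delta a b eta r : R) (D dD : R -> 'rV[R]_2) :
  0 <= L -> a <= b <= a + Delta -> 0 <= eta ->
  (forall t, a <= t <= b -> is_derive t 1 D (dD t)) ->
  (forall t, a <= t <= b -> `|D t| < r -> `|dD t| <= L * `|D t| + eta) ->
  gronwall_const R L Delta * (`|D a| + eta) < r ->
  `|D b| <= gronwall_const R L Delta * (`|D a| + eta).
Proof.
move=> L0 /andP[ab bD] eta0 hD hdD Cr.
have D0 : 0 <= Delta by lra.
set C := gronwall_const R L Delta in Cr *.
have C1 : 1 <= C by exact: gronwall_const_ge1.
have Br : 0 <= `|D a| + eta by rewrite addr_ge0.
(* On any initial piece where |D| < r the estimate holds up to its right end. A first exit time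
   would be such an end, and the estimate there is strictly below r. *)
have key c : a <= c <= b -> (forall t, a <= t < c -> `|D t| < r) ->
    `|D c| <= C * (`|D a| + eta).
  move=> /andP[ac cb] hr.
  pose q t := dot (D t) (D t); pose dq t := dot (dD t) (D t) + dot (D t) (dD t).
  have hq : forall t, a <= t <= c -> is_derive t 1 q (dq t).
    move=> t /andP[a_t tc]; have h := hD t; rewrite a_t (le_trans tc cb) in h.
    exact: is_derive_dot (h isT) (h isT).
  have := gronwall_scalar _ q dq (4 * L + 2) (2 * eta ^+ 2) a c ac _ _ hq.
  have -> : 0 <= 4 * L + 2 by lra.
  have -> : 0 <= 2 * eta ^+ 2 by rewrite mulr_ge0// sqr_ge0.
  move=> /(_ isT isT) H.
  have {}H : q c <= expR ((4 * L + 2) * (c - a)) * (q a + 2 * eta ^+ 2 * (c - a)).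
    apply: H => t /andP[a_t tc].
    have tab : a <= t <= b by rewrite !ltW// (lt_le_trans tc).
    have hdt := hdD t tab (hr t _); rewrite (ltW a_t) tc in hdt; move/(_ isT): hdt => hdt.
    have h1 := le_trans (ler_norm _) (dot_le _ (D t) (dD t)).
    have dsym : dot (dD t) (D t) = dot (D t) (dD t) by rewrite !dotE; ring.
    rewrite /dq dsym.
    have h2 : `|D t| * `|dD t| <= `|D t| * (L * `|D t| + eta) by rewrite ler_wpM2l.
    have h3 := dot_self_le _ (D t).
    (* Young's inequality: the mixed term 4 |D| eta is at most 2 |D|^2 + 2 eta^2. *)
    have h4 : 0 <= (`|D t| - eta) ^+ 2 by rewrite sqr_ge0.
    have h5 : L * `|D t| ^+ 2 <= L * q t by rewrite ler_wpM2l.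
    rewrite -/(q t) in h3.
    by nra.
  have h1 := dot_self_le _ (D c).
  have h2 := dot_self_ge _ (D a).
  set E := expR ((4 * L + 2) * Delta).
  have E1 : 1 <= E by rewrite -[leLHS]expR0 ler_expR mulr_ge0//; lra.
  have hE : expR ((4 * L + 2) * (c - a)) <= E.
    by rewrite ler_expR ler_wpM2l//; lra.
  have h3 : q a + 2 * eta ^+ 2 * (c - a) <= (2 + 2 * Delta) * (`|D a| + eta) ^+ 2.
    have e2 : 0 <= eta ^+ 2 by rewrite sqr_ge0.
    have h4 : 2 * eta ^+ 2 * (c - a) <= 2 * eta ^+ 2 * Delta by rewrite ler_wpM2l//; lra.
    have h5 : 0 <= `|D a| * eta by rewrite mulr_ge0.
    have h6 : 0 <= Delta * (2 * (`|D a| * eta) + `|D a| ^+ 2).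
      by rewrite mulr_ge0// addr_ge0// ?sqr_ge0// mulr_ge0.
    rewrite /q; lra.
  (* The bound on squares carries the factor C; as C >= 1 it may be replaced by C^2, which avoids
     the square root of C. *)
  rewrite -(@ler_pXn2r _ 2)// ?nnegrE ?mulr_ge0//; last by lra.
  apply: le_trans h1 _; apply: le_trans H _.
  have q0 : 0 <= q a by rewrite /q dotE -!expr2 addr_ge0 ?sqr_ge0.
  apply: (@le_trans _ _ (E * ((2 + 2 * Delta) * (`|D a| + eta) ^+ 2))).
    apply: ler_pM hE h3; first exact: expR_ge0.
    by rewrite addr_ge0// mulr_ge0// ?mulr_ge0 ?sqr_ge0//; lra.
  rewrite exprMn mulrA ler_wpM2r ?sqr_ge0//.
  have -> : E * (2 + 2 * Delta) = C by [].
  by rewrite expr2 ler_peMr//; lra.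
case: (ltP `|D b| r) => [Dbr|Dbr].
  apply: (key b); first by rewrite ab lexx.
  move=> t /andP[a_t tb]; rewrite ltNge; apply/negP => rD.
  have tb' : t <= b by exact: ltW.
  have [||s [s1 s2 s3]] := first_exit _ (fun s => `|D s|) a t r a_t _ _ rD.
  - move=> s /andP[a_s st]; apply: (norm_cont _ _ _ (dD s)); apply: hD.
    by rewrite a_s (le_trans st).
  - by apply: le_lt_trans Cr; nra.
  have := key s; case/andP: s1 => a_s st; rewrite a_s (le_trans st tb') => /(_ isT s3).
  by move=> h; move: s2; rewrite leNgt (le_lt_trans h).
have [||s [s1 s2 s3]] := first_exit _ (fun s => `|D s|) a b r ab _ _ Dbr.
- by move=> s ?; apply: (norm_cont _ _ _ (dD s)); apply: hD.
- by apply: le_lt_trans Cr; nra.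
by have := key s s1 s3 => h; move: s2; rewrite leNgt (le_lt_trans h).
Qed.

(** The forward inequality applied to the time-reversed function t |-> D(-t). *)
Lemma gronwall_bwd (R : realType) (L Delta a b eta r : R) (D dD : R -> 'rV[R]_2) :
  0 <= L -> a <= b <= a + Delta -> 0 <= eta ->
  (forall t, a <= t <= b -> is_derive t 1 D (dD t)) ->
  (forall t, a <= t <= b -> `|D t| < r -> `|dD t| <= L * `|D t| + eta) ->
  gronwall_const R L Delta * (`|D b| + eta) < r ->
  `|D a| <= gronwall_const R L Delta * (`|D b| + eta).
Proof.
move=> L0 /andP[ab bD] eta0 hD hdD Cr.
have := @gronwall_fwd R L Delta (- b) (- a) eta r (fun t => D (-1 * t + 0))
  (fun t => -1 *: dD (-1 * t + 0)) L0.
rewrite !addr0 !mulN1r !opprK; apply => //.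
- by lra.
- move=> t tab; apply: (is_derive_rV2_affine _ D); apply: hD; lra.
- by move=> t tab; rewrite scaleN1r normrN; apply: hdD; lra.
Qed.

(** * Global solutions for bounded Lipschitz fields *)

Lemma primitive_right (R : realType) (f : R -> R) (a : R) : continuous f ->
  forall t, a < t -> is_derive t 1
    (fun x => \int[lebesgue_measure]_(s in `[a, x]) f s) (f t).
Proof.
move=> cf t a_t.
have [||||d e] := @continuous_FTC1_closed R f a t (t + 1).
- by rewrite ltrDl.
- by apply: continuous_compact_integrable; [exact: segment_compact|apply: continuous_subspaceT].
- exact: a_t.
- exact: cf.
rewrite -e derive1E; exact: derivableP.
Qed.

(** An integral with lower end -1 has the right derivative only beyond -1. It serves for t >= 0, and
    its reflection for t < 0; the overlap (-1, 0) makes the glued function differentiable at 0. *)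
Lemma continuous_primitive (R : realType) (f : R -> R) : continuous f ->
  exists G : R -> R, G 0 = 0 /\ forall t : R, is_derive t 1 G (f t).
Proof.
move=> cf.
have cfN : continuous (fun t => f (- t)).
  by move=> t; apply: continuous_comp; [exact: opp_continuous|exact: cf].
pose A (x : R) := \int[lebesgue_measure]_(s in `[(- 1 : R), x]) f s.
pose B (x : R) := \int[lebesgue_measure]_(s in `[(- 1 : R), x]) f (- s).
have dA (t : R) : -1 < t -> is_derive t 1 (fun t => A t - A 0) (f t).
  move=> t1; have := is_deriveB (primitive_right R f (-1) cf t t1) (is_derive_cst (A 0) t (1:R)).
  by rewrite subr0.
have dB (t : R) : t < 1 -> is_derive t 1 (fun t => B 0 - B (- t)) (f t).
  move=> t1; have t1' : -1 < -1 * t + 0 by lra.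
  have := is_derive_affine _ _ _ _ _ _ (primitive_right R _ (-1) cfN _ t1').
  under eq_fun do rewrite addr0 mulN1r.
  move=> h; apply: is_derive_eq (is_deriveB (is_derive_cst (B 0) t (1:R)) h) _.
  by rewrite addr0 !mulN1r !opprK; exact: add0r.
(* On the overlap both candidates have derivative f and vanish at 0, so they coincide. *)
have AB (t : R) : -1 < t -> t < 0 -> A t - A 0 = B 0 - B (- t).
  move=> t1 t0.
  have := mvt_norm_le R (fun t => A t - A 0 - (B 0 - B (- t))) (fun=> 0) t 0 0 (ltW t0).
  rewrite mul0r oppr0 => h;
  suff : `|A 0 - A 0 - (B 0 - B 0) - (A t - A 0 - (B 0 - B (- t)))| <= 0.
    by rewrite !subrr !sub0r normrN normr_le0 subr_eq0 => /eqP.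
  apply: h => [s /andP[ts s0]|]; last by rewrite normr0.
  by apply: is_derive_eq (is_deriveB (dA s _) (dB s _)) _; rewrite ?subrr; lra.
pose G (t : R) := if 0 <= t then A t - A 0 else B 0 - B (- t).
exists G; split; first by rewrite /G lexx subrr.
move=> t; have [t0|t0] := ltP t 0.
  apply: (@near_eq_is_derive _ _ _ (fun t => B 0 - B (- t)) G); last by apply: dB; lra.
  near=> s; have s0 : s < 0 by near: s; exact: lt_nbhsl.
  by rewrite /G leNgt s0.
apply: (@near_eq_is_derive _ _ _ (fun t => A t - A 0) G); last by apply: dA; lra.
near=> s; have s0 : -1 < s by near: s; apply: lt_nbhsr; lra.
by rewrite /G; case: leP => // s1; rewrite AB.
Unshelve. all: by end_near. Qed.

Definition row2 (R : realType) (a b : R) : 'rV[R]_2 := \row_i (if i == 0 then a else b).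

Lemma row2_0 (R : realType) (a b : R) : row2 R a b 0 0 = a. Proof. by rewrite mxE. Qed.

Lemma row2_1 (R : realType) (a b : R) : row2 R a b 0 1 = b. Proof. by rewrite mxE. Qed.

Lemma coord_cont (R : realType) (f : R -> 'rV[R]_2) i :
  continuous f -> continuous (fun t => f t 0 i).
Proof.
by move=> cf t; apply: (@continuous_comp _ _ _ f (fun M => M 0 i) t (cf t)); exact: coord_continuous.
Qed.

Lemma continuous_primitive_rV2 (R : realType) (f : R -> 'rV[R]_2) : continuous f ->
  exists G : R -> 'rV[R]_2, G 0 = 0 /\ forall t : R, is_derive t 1 G (f t).
Proof.
move=> cf.
have [G0 [G00 dG0]] := continuous_primitive R _ (coord_cont R f 0 cf).
have [G1 [G10 dG1]] := continuous_primitive R _ (coord_cont R f 1 cf).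
exists (fun t => row2 R (G0 t) (G1 t)); split.
  by apply: rV2P; rewrite (row2_0, row2_1) mxE.
by move=> t; apply: is_derive_rV2;
  [under eq_fun do rewrite row2_0|under eq_fun do rewrite row2_1].
Qed.

(** Integration reproduces the weight exp(k |t|) with the gain 1/k. In the norm with this weight the
    Picard operator contracts on the whole line at once, without continuation of local solutions. *)
Lemma exp_growth (R : realType) (u du : R -> 'rV[R]_2) (a k : R) :
  0 < k -> 0 <= a -> u 0 = 0 ->
  (forall t : R, is_derive t 1 u (du t)) ->
  (forall t, `|du t| <= a * expR (k * `|t|)) ->
  forall t, `|u t| <= a / k * expR (k * `|t|).
Proof.
move=> k0 a0.
have scal (f df : R -> R) (t : R) : 0 <= t -> f 0 = 0 ->
    (forall t : R, is_derive t 1 f (df t)) ->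
    (forall t, `|df t| <= a * expR (k * `|t|)) ->
    f t <= a / k * expR (k * `|t|).
  move=> t0 f0 hf hdf.
  have hg (s : R) : is_derive s 1 (fun s : R => a / k * expR (k * s + 0)) (a * expR (k * s + 0)).
    have h := is_derive_affine _ _ _ _ _ _ (is_derive_expR (k * s + 0)).
    apply: is_derive_eq (is_deriveZ (a / k) h) _.
    by rewrite /GRing.scale/= mulrA divfK// gt_eqF.
  have := mvt_le R (f - (fun s : R => a / k * expR (k * s + 0)))
    (fun s => df s - a * expR (k * s + 0)) 0 t 0 t0.
  have -> : forall s, (f - (fun s : R => a / k * expR (k * s + 0))) s =
    f s - a / k * expR (k * s + 0) by [].
  have -> : forall s, (f - (fun s : R => a / k * expR (k * s + 0))) s =
    f s - a / k * expR (k * s + 0) by [].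
  rewrite mul0r f0 !addr0 mulr0 expR0 ger0_norm// sub0r opprK mulr1 => H.
  have : f t - a / k * expR (k * t) + a / k <= 0.
    apply: H => s /andP[s0 _].
    by have := hdf s; rewrite (gtr0_norm s0) addr0 subr_le0; apply: le_trans; rewrite ler_norm.
  have : 0 <= a / k by rewrite divr_ge0// ltW.
  by lra.
have vec (v dv : R -> 'rV[R]_2) (t : R) : 0 <= t -> v 0 = 0 ->
    (forall t : R, is_derive t 1 v (dv t)) ->
    (forall t, `|dv t| <= a * expR (k * `|t|)) ->
    `|v t| <= a / k * expR (k * `|t|).
  move=> t0 u0 hu hdu.
  have H i : `|v t 0 i| <= a / k * expR (k * `|t|).
    rewrite ler_norml; apply/andP; split.
      rewrite lerNl; apply: (scal (fun t => - v t 0 i) (fun t => - dv t 0 i)) => //.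
      - by rewrite u0 mxE oppr0.
      - by move=> s; apply: is_deriveN; exact: is_derive_coord.
      - by move=> s; rewrite normrN; apply: le_trans (hdu s); exact: coord_le_norm.
    apply: (scal (fun t => v t 0 i) (fun t => dv t 0 i)) => //.
    - by rewrite u0 mxE.
    - by move=> s; exact: is_derive_coord.
    - by move=> s; apply: le_trans (hdu s); exact: coord_le_norm.
  by rewrite norm_rV2_le !H.
move=> u0 hu hdu t; have [t0|t0] := leP 0 t; first exact: (vec u du).
have := vec (fun s => u (-1 * s + 0)) (fun s => -1 *: du (-1 * s + 0)) (- t).
have -> : -1 * - t + 0 = t by ring.
rewrite normrN mulr0 addr0; apply => //; first lra.
- by move=> s; exact: (is_derive_rV2_affine _ u).
- by move=> s; rewrite scaleN1r normrN (le_trans (hdu _))// addr0 mulN1r normrN.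
Qed.

Lemma le_geometric (R : realType) (a b c : R) :
  (forall n, a <= b + c / 2 ^+ n) -> a <= b.
Proof.
move=> h; rewrite leNgt; apply/negP => ba.
have [c0|c0] := leP c 0; first by have := h 0%N; rewrite expr0 divr1; lra.
have d0 : 0 < a - b by rewrite subr_gt0.
have := @upper_nthrootP R (c / (a - b)) _ (leqnn _).
set n := Num.Def.archi_bound _ => H; have := h n.
rewrite -lerBlDl ler_pdivlMr ?exprn_gt0// mulrC -ler_pdivlMr//.
by rewrite leNgt H.
Qed.

(** Nested intervals: the lower ends u_n - 2K/2^n increase, the upper ends u_n + 2K/2^n decrease,
    and the supremum of the lower ends lies in all of them. *)
Lemma geometric_limit (R : realType) (u : nat -> R) (K : R) :
  (forall n, `|u n.+1 - u n| <= K / 2 ^+ n) ->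
  exists l, forall n, `|l - u n| <= 2 * K / 2 ^+ n.
Proof.
move=> h.
pose lo n := u n - 2 * K / 2 ^+ n; pose hi n := u n + 2 * K / 2 ^+ n.
have half n : 2 * K / 2 ^+ n.+1 = K / 2 ^+ n.
  by rewrite exprS invfM [2 * K]mulrC mulrA mulfK// pnatr_eq0.
have K0 n : 0 <= K / 2 ^+ n by apply: le_trans (h n).
have lo_homo : {homo lo : n m / (n <= m)%N >-> n <= m}.
  apply: homo_leq => [x|x y z|n]; [exact: lexx|exact: le_trans|].
  by rewrite /lo half; have := h n; rewrite ler_norml; lra.
have hi_homo : {homo hi : n m / (n <= m)%N >-> m <= n}.
  apply: (homo_leq (r := fun x y => y <= x)) => [x|y x z a b|n]; [exact: lexx|exact: le_trans b a|].
  by rewrite /hi half; have := h n; rewrite ler_norml; lra.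
have lohi n m : lo n <= hi m.
  apply: (@le_trans _ _ (lo (maxn n m))); first by apply: lo_homo; exact: leq_maxl.
  apply: (@le_trans _ _ (hi (maxn n m))); last by apply: hi_homo; exact: leq_maxr.
  by rewrite /lo /hi; have := K0 (maxn n m); lra.
have S : has_sup (range lo).
  by split; [exists (lo 0%N), 0%N|exists (hi 0%N) => _ [n _ <-]].
exists (sup (range lo)) => n; rewrite ler_norml; apply/andP; split.
  have : lo n <= sup (range lo) by apply: ub_le_sup; [case: S|exists n].
  by rewrite /lo; lra.
have : sup (range lo) <= hi n by apply: ge_sup; [case: S|move=> _ [m _ <-]].
by rewrite /hi; lra.
Qed.

Lemma lipschitz_cont (R : realType) (V W : normedModType R) (f : V -> W) (L : R) :
  (forall u v, `|f u - f v| <= L * `|u - v|) -> continuous f.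
Proof.
move=> hL u; apply/cvgrPdist_lt => e e0.
have L1 : 0 < `|L| + 1 by rewrite ltr_pwDr.
near=> v; apply: le_lt_trans (hL u v) _.
apply: (@le_lt_trans _ _ ((`|L| + 1) * `|u - v|)).
  by rewrite ler_wpM2r// (le_trans (ler_norm L))// lerDl.
rewrite -ltr_pdivlMl// mulrC; near: v.
by apply: (@cvgr_dist_lt _ _ _ (nbhs u) _ id u); [exact: cvg_id|rewrite divr_gt0].
Unshelve. all: by end_near. Qed.

(** With the weight exp(2L |t|) the Picard operator has contraction ratio 1/2. Boundedness of F
    makes the first step finite in this norm, of size M = B/(2L). *)
Lemma picard (R : realType) (F : 'rV[R]_2 -> 'rV[R]_2) (L B : R) (xi : 'rV[R]_2) :
  (forall u v, `|F u - F v| <= L * `|u - v|) -> (forall u, `|F u| <= B) ->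
  exists y : R -> 'rV[R]_2, y 0 = xi /\ forall t : R, is_derive t 1 y (F (y t)).
Proof.
wlog L0 : L / 0 < L.
  move=> H hL; apply: (H (`|L| + 1)) => [|u v]; first by rewrite ltr_pwDr.
  by apply: le_trans (hL u v) _; rewrite ler_wpM2r// (le_trans (ler_norm L))// lerDl.
move=> hL hB.
have cF : continuous F by exact: lipschitz_cont hL.
have B0 : 0 <= B by apply: le_trans (hB 0).
(* [P] is a primitive operator made total by choice; its value at a discontinuous function is
   arbitrary. *)
have /choice[P hP] : forall f : R -> 'rV[R]_2, exists G : R -> 'rV[R]_2,
    continuous f -> G 0 = 0 /\ forall t : R, is_derive t 1 G (f t).
  move=> f; case: (pselect (continuous f)) => [cf|ncf]; last by exists f.
  by have [G hG] := continuous_primitive_rV2 R f cf; exists G.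
pose S (y : R -> 'rV[R]_2) : R -> 'rV[R]_2 := fun t => xi + P (F \o y) t.
pose y n := iter n S (cst xi).
have dS (z : R -> 'rV[R]_2) : continuous z -> forall t : R, is_derive t 1 (S z) (F (z t)).
  move=> cz t.
  have cFz : continuous (F \o z) by move=> s; apply: continuous_comp; [exact: cz|exact: cF].
  by apply: is_derive_eq (is_deriveD (is_derive_cst xi t (1:R)) ((hP _ cFz).2 t)) _; rewrite add0r.
have S0 (z : R -> 'rV[R]_2) : continuous z -> S z 0 = xi.
  move=> cz; rewrite /S (hP _ _).1 ?addr0//.
  by move=> s; apply: continuous_comp; [exact: cz|exact: cF].
have cS (z : R -> 'rV[R]_2) : continuous z -> continuous (S z).
  by move=> cz t; exact: derive_cont (dS z cz t).
have cy n : continuous (y n).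
  by elim: n => [|n IH]; [exact: cst_continuous|exact: cS].
pose M := B / (2 * L).
have L20 : 0 < 2 * L by lra.
have M0 : 0 <= M by rewrite divr_ge0// ltW.
have step (z w : R -> 'rV[R]_2) (c : R) : continuous z -> continuous w -> 0 <= c ->
    (forall t : R, `|z t - w t| <= c * expR (2 * L * `|t|)) ->
    forall t, `|S z t - S w t| <= c / 2 * expR (2 * L * `|t|).
  move=> cz cw c0 hzw t.
  have -> : c / 2 = L * c / (2 * L) by field; rewrite gt_eqF.
  apply: (exp_growth R (fun t => S z t - S w t) (fun t => F (z t) - F (w t))) => //.
  - by rewrite mulr_ge0// ltW.
  - by rewrite !S0// subrr.
  - by move=> s; apply: is_deriveB; exact: dS.
  - by move=> s; rewrite -mulrA (le_trans (hL _ _))// ler_wpM2l// ltW.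
have bnd n (t : R) : `|y n.+1 t - y n t| <= M / 2 ^+ n * expR (2 * L * `|t|).
  elim: n t => [|n IH] t.
    rewrite expr0 divr1.
    apply: (exp_growth R (fun t => y 1%N t - y 0%N t) (fun t => F xi)) => //.
    - have -> : y 1%N 0 = xi by exact: (S0 (y 0%N) (cy 0%N)).
      exact: subrr.
    - move=> s; apply: is_derive_eq (is_deriveB (dS (y 0%N) (cy 0%N) s) (is_derive_cst xi s (1:R))) _.
      by rewrite subr0.
    - by move=> s; rewrite (le_trans (hB _))// ler_peMr// -[leLHS]expR0 ler_expR mulr_ge0// ltW.
  rewrite exprSr invfM mulrA.
  by apply: (step (y n.+1) (y n)) => //; rewrite divr_ge0// exprn_ge0.
have /choice[z hz] : forall t : R, exists v : 'rV[R]_2, forall n,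
    `|v - y n t| <= 2 * M / 2 ^+ n * expR (2 * L * `|t|).
  move=> t.
  have H i n : `|y n.+1 t 0 i - y n t 0 i| <= M * expR (2 * L * `|t|) / 2 ^+ n.
    rewrite mulrAC; apply: le_trans (bnd n t).
    by have := coord_le_norm R (y n.+1 t - y n t) i; rewrite !mxE.
  have [l0 h0] := geometric_limit R _ _ (H 0).
  have [l1 h1] := geometric_limit R _ _ (H 1).
  exists (row2 R l0 l1) => n; rewrite norm_rV2_le !mxE/=.
  have -> : 2 * M / 2 ^+ n * expR (2 * L * `|t|) = 2 * (M * expR (2 * L * `|t|)) / 2 ^+ n by ring.
  by rewrite h0 h1.
(* All iterates are B-Lipschitz, since their derivatives are values of F or zero; the pointwise
   limit inherits this. *)
have cz : continuous z.
  apply: (@lipschitz_cont R _ _ _ B) => s t.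
  wlog st : s t / s <= t.
    move=> H; have [/H//|/ltW/H] := leP s t.
    by rewrite -normrN opprB -[X in _ <= _ * X]normrN opprB.
  apply: (@le_geometric R _ _ (2 * M * expR (2 * L * `|s|) + 2 * M * expR (2 * L * `|t|))) => n.
  have yl : `|y n t - y n s| <= B * (t - s).
    case: n => [|n]; first by rewrite subrr normr0 mulr_ge0// subr_ge0.
    by apply: (mvt_rV2_le R (y n.+1) (fun t => F (y n t)) s t B st) => r _; [exact: dS|exact: hB].
  have -> : z s - z t = (z s - y n s) - (y n t - y n s) - (z t - y n t).
    by rewrite opprB; apply/rowP => i; rewrite !mxE; ring.
  apply: le_trans (ler_normB _ _) _; apply: le_trans (lerD (ler_normB _ _) (lexx _)) _.
  have -> : `|s - t| = t - s by rewrite distrC ger0_norm// subr_ge0.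
  have -> : (2 * M * expR (2 * L * `|s|) + 2 * M * expR (2 * L * `|t|)) / 2 ^+ n =
    2 * M / 2 ^+ n * expR (2 * L * `|s|) + 2 * M / 2 ^+ n * expR (2 * L * `|t|) by ring.
  by have := hz s n; have := hz t n; lra.
(* Both sides are within a constant times 2^-n of the iterate [y n.+1]. *)
have zS : z = S z.
  apply/funext => t; apply/eqP; rewrite -subr_eq0 -normr_le0.
  apply: (@le_geometric R _ _ (2 * M * expR (2 * L * `|t|))) => n; rewrite add0r.
  have -> : z t - S z t = (z t - y n.+1 t) - (S z t - S (y n) t).
    by rewrite opprB addrA subrK.
  apply: le_trans (ler_normB _ _) _.
  have h1 := hz t n.+1.
  have h2 := step z (y n) (2 * M / 2 ^+ n) cz (cy n) _ (hz^~ n) t.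
  have {}h2 := h2 (divr_ge0 (mulr_ge0 (ler0n _ _) M0) (exprn_ge0 _ (ler0n _ _))).
  apply: le_trans (lerD h1 h2) _.
  rewrite exprSr invfM -!mulrA [2^-1 * _]mulrC !mulrA.
  by have : 0 <= 2 * M / 2 ^+ n * expR (2 * L * `|t|); [apply: le_trans (hz t n)|lra].
by exists z; split; [rewrite zS S0|move=> t; rewrite {1}zS; exact: dS].
Qed.

(** * Fields of class C1 *)

(** Continuity holds at points of K within the whole space, so q may leave K. This covers perturbed
    points p + D that step out of the compact set. *)
Lemma compact_uniformly_continuous (R : realType) (X : pseudoMetricType R)
    (V : normedModType R) (f : X -> V) (K : set X) : compact K ->
  (forall p, K p -> {for p, continuous f}) ->
  forall eta, 0 < eta -> exists2 delta, 0 < delta &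
    forall p q, K p -> ball p delta q -> `|f p - f q| < eta.
Proof.
move=> /compact_near_coveringP cK cf eta eta0.
have : \forall i \near (0^'+ : set_system R), K `<=` (fun p => forall q, ball p i q -> `|f p - f q| < eta).
  apply: cK => p Kp; have e20 : 0 < eta / 2 by rewrite divr_gt0.
  have /cvgrPdist_lt /(_ _ e20) /nbhs_ballP[e /= e0 he] := cf p Kp.
  (* For p' within e/2 of p and a radius i < e/2, both p' and its neighbour q lie within e of p. *)
  exists (ball p (e / 2), [set i | i < e / 2]).
    split; first by apply: nbhsx_ballx; rewrite divr_gt0.
    by apply: nbhs_right_lt; rewrite divr_gt0.
  move=> [p' i] /= [pp' ie] q p'q.
  have h1 := he p' (le_ball _ pp'); have h2 := he q (ball_split pp' (le_ball (ltW ie) p'q)).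
  rewrite -(subrK (f p) (f p')) -addrA (le_lt_trans (ler_normD _ _))//.
  by rewrite [eta]splitr ltrD// distrC h1// ler_pdivrMr// mulr2n mulrDr mulr1 lerDl ltW.
move=> near0; have pos0 : \forall i \near (0 : R)^'+, 0 < i by exact: nbhs_right_gt.
have [d [d0 hd]] := filter_ex (filterI pos0 near0).
by exists d => // p q Kp; exact: hd.
Qed.

(** For a <= b, the nearest-point projection of the line onto [a, b]. *)
Definition clip (R : realType) (a b x : R) : R := Num.max a (Num.min b x).

Lemma clip_lipschitz (R : realType) (a b x y : R) : `|clip R a b x - clip R a b y| <= `|x - y|.
Proof.
wlog xy : x y / x <= y.
  by move=> H; have [/H//|/ltW/H] := leP x y; rewrite distrC [leRHS]distrC.
rewrite distrC [leRHS]distrC [leRHS]ger0_norm ?subr_ge0// ler_norml.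
by rewrite /clip !maxEle !minEle; do ! case: ifP; lra.
Qed.

Lemma clip_in (R : realType) (a b x : R) : a <= b -> a <= clip R a b x <= b.
Proof. by rewrite /clip !maxEle !minEle; do ! case: ifP; lra. Qed.

Lemma clip_id (R : realType) (a b x : R) : a <= x <= b -> clip R a b x = x.
Proof. by rewrite /clip !maxEle !minEle; do ! case: ifP; lra. Qed.

(** The max-norm ball is a square, so clipping each coordinate retracts the plane onto it with
    Lipschitz constant 1. *)
Definition clamp (R : realType) (K : R) (p : 'rV[R]_2) : 'rV[R]_2 :=
  map_mx (clip R (- K) K) p.

Lemma clamp_lipschitz (R : realType) (K : R) (p q : 'rV[R]_2) :
  `|clamp R K p - clamp R K q| <= `|p - q|.
Proof.
have H i : `|(clamp R K p - clamp R K q) 0 i| <= `|p - q|.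
  rewrite !mxE; apply: le_trans (clip_lipschitz _ _ _ _ _) _.
  by have := coord_le_norm R (p - q) i; rewrite !mxE.
by rewrite norm_rV2_le !H.
Qed.

Lemma clamp_in (R : realType) (K : R) (p : 'rV[R]_2) : 0 <= K -> `|clamp R K p| <= K.
Proof.
move=> K0; have KK : - K <= K by lra.
by rewrite norm_rV2_le !mxE !ler_norml !clip_in.
Qed.

Lemma clamp_id (R : realType) (K : R) (p : 'rV[R]_2) : `|p| <= K -> clamp R K p = p.
Proof.
by rewrite norm_rV2_le !ler_norml => /andP[h0 h1]; apply: rV2P; rewrite !mxE clip_id.
Qed.

Lemma compact_ball (R : realType) (K : R) : compact [set p : 'rV[R]_2 | `|p| <= K].
Proof.
apply: bounded_closed_compact.
  by exists K; split; [exact: num_real|move=> M KM p /= /le_trans; apply; exact: ltW].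
have -> : [set p : 'rV[R]_2 | `|p| <= K] = (fun p : 'rV[R]_2 => `|p|) @^-1` [set y | y <= K] by [].
by apply: preimage_closed; [move=> p _; exact: norm_continuous|exact: closed_le].
Qed.

Lemma chain_rule (R : realType) (psi : 'rV[R]_2 -> 'rV[R]_2) (u : R -> 'rV[R]_2) (t : R) du :
  differentiable psi (u t) -> is_derive t 1 u du ->
  is_derive t 1 (fun s => psi (u s)) (du *m jacobian psi (u t)).
Proof.
move=> dpsi [du1 <-].
have du' : differentiable u t by apply/derivable1_diffP.
have dc : differentiable (psi \o u) t by exact: differentiable_comp.
split; first exact: diff_derivable.
have e1 : 'D_1 (psi \o u) t = 'd (psi \o u) t 1 by exact: deriveE.
have e2 : 'D_1 u t = 'd u t 1 by exact: deriveE.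
have e3 : 'd (psi \o u) t = 'd psi (u t) \o 'd u t :> (R -> 'rV[R]_2).
  exact: diff_comp.
by rewrite [LHS]e1 e3 e2 /jacobian mul_rV_lin1.
Qed.

Lemma is_derive_segment (R : realType) (p D : 'rV[R]_2) (s : R) :
  is_derive s 1 (fun s : R => p + s *: D) D.
Proof.
have H i : is_derive s 1 (fun s : R => (p + s *: D) 0 i) (D 0 i).
  have h := is_deriveD (is_derive_cst (p 0 i) s (1:R))
    (is_deriveM (is_derive_id s (1:R)) (is_derive_cst (D 0 i) s (1:R))).
  under eq_fun do rewrite !mxE.
  by apply: is_derive_eq h _; rewrite /GRing.scale/=; ring.
by apply: is_derive_rV2; exact: H.
Qed.

Lemma mx_coord_le (R : realType) m n (M : 'M[R]_(m, n)) i j : `|M i j| <= `|M|.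
Proof. by rewrite [leRHS]/Num.Def.normr/= mx_normrE; exact: (le_bigmax _ _ (i, j)). Qed.

Lemma C1_jacobian_bounded (R : realType) (psi : 'rV[R]_2 -> 'rV[R]_2) (K : R) :
  C1 psi -> exists2 a, 0 <= a & forall p : 'rV[R]_2, `|p| <= K ->
    forall i j, `|jacobian psi p i j| <= a.
Proof.
move=> [dpsi cJ].
have cN : continuous (fun p => `|jacobian psi p|).
  by move=> p; apply: continuous_comp; [exact: cJ|exact: norm_continuous].
have [K0|K0] := ltP K 0.
  by exists 0 => // p pK; have := le_trans (normr_ge0 p) pK; rewrite leNgt K0.
have ne : [set p : 'rV[R]_2 | `|p| <= K] !=set0 by exists 0; rewrite /= normr0.
have [c _ hc] := EVT_max_rV ne (compact_ball R K) (continuous_subspaceT cN).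
exists `|jacobian psi c| => // p pK i j; apply: le_trans (mx_coord_le _ _ _ _ _ _) _.
by apply: hc; rewrite inE.
Qed.

(** The ball is convex: the segment from v to u stays where the Jacobian is bounded, and the mean
    value inequality applies along it. *)
Lemma C1_lipschitz (R : realType) (psi : 'rV[R]_2 -> 'rV[R]_2) (K : R) :
  C1 psi -> exists2 L, 0 <= L & forall u v : 'rV[R]_2, `|u| <= K -> `|v| <= K ->
    `|psi u - psi v| <= L * `|u - v|.
Proof.
move=> hpsi; have [a a0 ha] := C1_jacobian_bounded R psi K hpsi.
have [dpsi _] := hpsi.
exists (2 * a) => [|u v uK vK]; first by rewrite mulr_ge0.
have := mvt_rV2_le R (fun s => psi (v + s *: (u - v)))
  (fun s => (u - v) *m jacobian psi (v + s *: (u - v))) 0 1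
  (2 * a * `|u - v|) ler01.
have -> : v + 1 *: (u - v) = u by rewrite scale1r addrC subrK.
have -> : v + 0 *: (u - v) = v by rewrite scale0r addr0.
rewrite subr0 mulr1; apply.
- by move=> s _; apply: chain_rule (dpsi _) _; exact: is_derive_segment.
- move=> s /andP[s0 s1]; apply: norm_mulmx2_le => i j.
  apply: ha; have -> : v + s *: (u - v) = (1 - s) *: v + s *: u.
    by apply/rowP => k; rewrite !mxE; ring.
  rewrite (le_trans (ler_normD _ _))// !normrZ (gtr0_norm s0) gtr0_norm ?subr_gt0//.
  by nra.
Qed.

(** The mean value inequality is applied to s |-> psi(p + s D) - s D J(p), where J is the Jacobian;
    its derivative D (J(p + s D) - J(p)) is small by uniform continuity of J near the ball. Taking
    eta/2 pays for the factor 2 of a row times a matrix. *)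
Lemma C1_uniform_linearization (R : realType) (psi : 'rV[R]_2 -> 'rV[R]_2) (K eta : R) :
  C1 psi -> 0 < eta -> exists2 delta, 0 < delta & forall p D : 'rV[R]_2, `|p| <= K -> `|D| < delta ->
    `|psi (p + D) - psi p - D *m jacobian psi p| <= eta * `|D|.
Proof.
move=> [dpsi cJ] eta0.
have e2 : 0 < eta / 2 by rewrite divr_gt0.
have [d d0 hd] := compact_uniformly_continuous R 'rV[R]_2 _ _ _ (compact_ball R K)
  (fun p _ => cJ p) _ e2.
exists d => // p D pK Dd.
have hs (s : R) : is_derive s 1 (fun s : R => psi (p + s *: D) - (0 + s *: (D *m jacobian psi p)))
    (D *m jacobian psi (p + s *: D) - D *m jacobian psi p).
  apply: is_deriveB; last exact: is_derive_segment.
  by apply: chain_rule (dpsi _) _; exact: is_derive_segment.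
have := mvt_rV2_le R _ _ 0 1 (eta * `|D|) ler01 (fun s _ => hs s).
rewrite !scale1r !scale0r !add0r addr0 !subr0 mulr1.
rewrite addrAC; apply => s /andP[s0 s1].
rewrite -mulmxBr (_ : eta = 2 * (eta / 2)); last by lra.
apply: norm_mulmx2_le => i j.
apply: (@le_trans _ _ `|jacobian psi (p + s *: D) - jacobian psi p|).
  exact: mx_coord_le.
rewrite distrC ltW// hd// -ball_normE/= opprD addrA subrr sub0r normrN normrZ gtr0_norm//.
by apply: le_lt_trans Dd; rewrite ler_piMl// ltW.
Qed.

(** * Multipliers of the linearization and of its adjoint *)

Lemma det2 (R : comNzRingType) (M : 'M[R]_2) :
  \det M = M 0 0 * M 1 1 - M 0 1 * M 1 0.
Proof.
rewrite (expand_det_row _ 0) !big_ord_recl big_ord0 addr0 /cofactor !det_mx11 !mxE.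
have -> : lift ord0 ord0 = 1 :> 'I_2 by apply/val_inj.
have -> : lift 1 0 = 0 :> 'I_2 by apply/val_inj.
rewrite [X in (-1) ^+ X * M 1 1](_ : _ = 0%N)// [X in (-1) ^+ X * M 1 0](_ : _ = 1%N)//.
by rewrite expr0 expr1 mul1r mulN1r mulrN.
Qed.

(* If a is a left and b a right eigenvector for the eigenvalue 1 with a
   orthogonal to b, then b is a multiple of the rotation of a; this forces
   trace 2 and determinant 1, so 1 is a double root. *)
Lemma simple_eigenvalue_dot (R : realType) (M : 'M[R]_2) (a b : 'rV[R]_2) :
  mup 1 (char_poly M) = 1%N -> a != 0 -> b != 0 ->
  a *m M = a -> b *m M^T = b -> dot a b != 0.
Proof.
move=> M1 a0 b0 aM bM; apply/eqP => ab.
have e1 : a 0 0 * M 0 0 + a 0 1 * M 1 0 = a 0 0 by rewrite -mulmx2E aM.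
have e2 : a 0 0 * M 0 1 + a 0 1 * M 1 1 = a 0 1 by rewrite -mulmx2E aM.
have e3 : b 0 0 * M 0 0 + b 0 1 * M 0 1 = b 0 0.
  by rewrite -[RHS](congr1 (fun v : 'rV[R]_2 => v 0 0) bM) mulmx2E !mxE.
have e4 : b 0 0 * M 1 0 + b 0 1 * M 1 1 = b 0 1.
  by rewrite -[RHS](congr1 (fun v : 'rV[R]_2 => v 0 1) bM) mulmx2E !mxE.
rewrite dotE in ab.
have N0 : a 0 0 ^+ 2 + a 0 1 ^+ 2 != 0.
  apply: contra a0; rewrite paddr_eq0 ?sqr_ge0// !sqrf_eq0 => /andP[/eqP h0 /eqP h1].
  by apply/eqP/rV2P; rewrite mxE.
(* [k] is the coefficient of b along [perp a]. *)
set k := (b 0 0 * a 0 1 - b 0 1 * a 0 0) / (a 0 0 ^+ 2 + a 0 1 ^+ 2).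
have b00 : b 0 0 = k * a 0 1.
  rewrite /k mulrAC; apply: (canRL (mulfK N0)).
  have : a 0 0 * (a 0 0 * b 0 0 + a 0 1 * b 0 1) = 0 by rewrite ab mulr0.
  by lra.
have b01 : b 0 1 = - k * a 0 0.
  rewrite /k mulNr mulrAC -mulNr; apply: (canRL (mulfK N0)).
  have : a 0 1 * (a 0 0 * b 0 0 + a 0 1 * b 0 1) = 0 by rewrite ab mulr0.
  by lra.
have k0 : k != 0.
  apply: contra b0 => /eqP k0; rewrite k0 in b00 b01.
  by apply/eqP/rV2P; rewrite mxE ?b00 ?b01; lra.
have e3' : a 0 1 * M 0 0 - a 0 0 * M 0 1 = a 0 1.
  by apply: (mulfI k0); rewrite -[RHS]b00 -e3 b00 b01; ring.
have e4' : a 0 1 * M 1 0 - a 0 0 * M 1 1 = - a 0 0.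
  apply: (mulfI k0); have -> : k * - a 0 0 = - k * a 0 0 by ring.
  by rewrite -b01 -e4 b00 b01; ring.
(* Rewritten in terms of a, the eigenvector equations of b combine with those of a into (M00 + M11 -
   2) a = 0. *)
have tr : M 1 1 = 2 - M 0 0.
  have t0 : a 0 0 * (M 0 0 + M 1 1 - 2) = 0 by lra.
  have t1 : a 0 1 * (M 0 0 + M 1 1 - 2) = 0 by lra.
  have : (a 0 0 ^+ 2 + a 0 1 ^+ 2) * (M 0 0 + M 1 1 - 2) = 0.
    by rewrite mulrDl !expr2 -!mulrA t0 t1 !mulr0 addr0.
  by move/eqP; rewrite mulf_eq0 (negbTE N0)/= => /eqP; lra.
(* With trace 2, this identity says that the determinant is 1. *)
have dt : M 0 1 * M 1 0 = - (M 0 0 - 1) ^+ 2.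
  have : (a 0 0 ^+ 2 + a 0 1 ^+ 2) * (M 0 1 * M 1 0 + (M 0 0 - 1) ^+ 2) = 0.
    have f1 : a 0 1 * M 1 0 = - a 0 0 * (M 0 0 - 1) by lra.
    have f2 : a 0 0 * M 0 1 = a 0 1 * (M 0 0 - 1) by lra.
    have g1 : a 0 0 ^+ 2 * (M 0 1 * M 1 0) = a 0 0 * (a 0 0 * M 0 1) * M 1 0 by ring.
    have g2 : a 0 1 ^+ 2 * (M 0 1 * M 1 0) = a 0 1 * (a 0 1 * M 1 0) * M 0 1 by ring.
    have g3 : a 0 0 * (a 0 1 * (M 0 0 - 1)) * M 1 0 = a 0 0 * (M 0 0 - 1) * (a 0 1 * M 1 0) by ring.
    have g4 : a 0 1 * (- a 0 0 * (M 0 0 - 1)) * M 0 1 = - a 0 1 * (M 0 0 - 1) * (a 0 0 * M 0 1) by ring.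
    by rewrite mulrDr [X in X + _]mulrDl g1 g2 f1 f2 g3 g4 f1 f2; ring.
  by move/eqP; rewrite mulf_eq0 (negbTE N0)/= addr_eq0 => /eqP.
have cp : char_poly M = ('X - 1%:P) ^+ 2.
  rewrite /char_poly det2 !mxE/= tr.
  rewrite !mulr0n !mulr1n !sub0r mulrNN -polyCM dt.
  by rewrite polyCN polyC_exp !polyCB; ring.
by move: M1; rewrite cp mup_XsubCX eqxx.
Qed.

Lemma periodic_reduce (R : realType) (V : zmodType) (f : R -> V) (T : R) :
  0 < T -> periodic f T -> forall s, exists2 t, t \in `[0, T] & f s = f t.
Proof.
move=> T0 fT s; pose k := Num.floor (s / T).
have /andP[k1 k2] := floor_itv (s / T); rewrite -/k in k1 k2.
rewrite ler_pdivlMr// in k1; rewrite ltr_pdivrMr// intrD mulrDl mul1r in k2.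
have fk (m : int) (u : R) : f (u - m%:~R * T) = f u.
  case: m => n.
    by rewrite -[RHS](congr1 f (subrK (n%:R * T) u)) mulr_natl (periodicn fT).
  by rewrite NegzE mulrNz mulNr opprK [_.+1%:~R * T]mulr_natl (periodicn fT).
exists (s - k%:~R * T); first by rewrite in_itv/= subr_ge0 k1/= lerBlDl ltW.
by rewrite fk.
Qed.

Lemma periodic_bounded (R : realType) (f : R -> 'rV[R]_2) (T : R) :
  0 < T -> periodic f T -> continuous f -> exists2 K, 0 <= K & forall t, `|f t| <= K.
Proof.
move=> T0 fT cf.
have cn : continuous (fun t => `|f t|).
  by move=> t; apply: (@continuous_comp _ _ _ f (fun v => `|v|) t (cf t)); exact: norm_continuous.
have [c _ hc] := EVT_max (ltW T0) (continuous_subspaceT cn).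
exists `|f c| => // s; have [t tT ->] := periodic_reduce R _ f T T0 fT s.
exact: hc.
Qed.

Lemma solution_cont (R : realType) F (x : R -> 'rV[R]_2) :
  solves_on setT F x -> continuous x.
Proof. by move=> h t; apply: derive_cont (h t I). Qed.

(** Gronwall's inequality with zero data, forwards or backwards. It makes eigenfunctions nonzero at
    every time and identifies solutions that agree once. *)
Lemma lin_solution_eq0 (R : realType) (A : R -> 'M[R]_2) (a : R) (u : R -> 'rV[R]_2) :
  (forall t i j, `|A t i j| <= a) -> solves_on setT (lin A) u ->
  forall s t, u s = 0 -> u t = 0.
Proof.
move=> hA hu s t us.
have a0 : 0 <= 2 * a by rewrite mulr_ge0// (le_trans _ (hA 0 0 0)).
have hd r : `|lin A r (u r)| <= 2 * a * `|u r| + 0 by rewrite addr0 norm_mulmx2_le.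
apply/eqP; rewrite -normr_le0.
have [st|/ltW ts] := leP s t.
  have := gronwall_fwd R (2 * a) (t - s) s t 0 1 u (fun r => lin A r (u r)) a0.
  by rewrite us normr0 addr0 mulr0; apply => // [|r _]; [lra|exact: hu].
have := gronwall_bwd R (2 * a) (s - t) t s 0 1 u (fun r => lin A r (u r)) a0.
by rewrite us normr0 addr0 mulr0; apply => // [|r _]; [lra|exact: hu].
Qed.

Lemma adjoint_bounded (R : realType) (A : R -> 'M[R]_2) (a : R) :
  (forall t i j, `|A t i j| <= a) -> forall t i j, `|adjoint A t i j| <= a.
Proof. by move=> hA t i j; rewrite /adjoint !mxE normrN. Qed.

Lemma solves_linB (R : realType) (A : R -> 'M[R]_2) (u v : R -> 'rV[R]_2) (k : R) :
  solves_on setT (lin A) u -> solves_on setT (lin A) v ->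
  solves_on setT (lin A) (fun t => u t - k *: v t).
Proof.
move=> hu hv t _; apply: is_derive_eq (is_deriveB (hu t I) (is_deriveZ k (hv t I))) _.
by rewrite /lin mulmxBl -scalemxAl.
Qed.

Lemma derive0_cst (R : realType) (f : R -> R) :
  (forall t : R, is_derive t 1 f 0) -> forall s t, f s = f t.
Proof.
move=> hf s t; wlog st : s t / s <= t.
  by move=> H; have [/H//|/ltW/H] := leP s t.
have := mvt_norm_le R f (fun=> 0) s t 0 st (fun r _ => hf r).
rewrite mul0r => H; apply/esym/eqP; rewrite -subr_eq0 -normr_le0.
by apply: H => r _; rewrite normr0.
Qed.

Lemma dot_adjoint_cst (R : realType) (A : R -> 'M[R]_2) (z y : R -> 'rV[R]_2) :
  solves_on setT (lin (adjoint A)) z -> solves_on setT (lin A) y ->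
  forall s t, dot (z s) (y s) = dot (z t) (y t).
Proof.
move=> hz hy; apply: derive0_cst => t.
apply: is_derive_eq (is_derive_dot _ _ _ _ _ _ (hz t I) (hy t I)) _.
by rewrite /lin /adjoint dot_adjoint addNr.
Qed.

Lemma velocity_solves_linearization (R : realType) (psi : 'rV[R]_2 -> 'rV[R]_2) x0 :
  C1 psi -> solves_on setT (fun=> psi) x0 ->
  solves_on setT (lin (linearization psi x0)) (fun t => psi (x0 t)).
Proof. by move=> [dpsi _] hx t _; apply: chain_rule (dpsi _) (hx t I). Qed.

(** The velocity solves the linearized system, so one zero makes it vanish identically. The orbit is
    then constant and T/2 is a period, against the minimality of T. *)
Lemma velocity_neq0 (R : realType) (psi : 'rV[R]_2 -> 'rV[R]_2) x0 (T a : R) :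
  C1 psi -> solves_on setT (fun=> psi) x0 -> smallest_period x0 T ->
  (forall t i j, `|linearization psi x0 t i j| <= a) ->
  forall t, psi (x0 t) != 0.
Proof.
move=> hpsi hx [T0 xT minT] hA t; apply/eqP => pt0.
have p0 s : psi (x0 s) = 0.
  exact: (lin_solution_eq0 R _ a _ hA (velocity_solves_linearization R _ _ hpsi hx) t s).
have xc s r : x0 s = x0 r.
  have H i : x0 s 0 i = x0 r 0 i.
    apply: (derive0_cst R (fun t => x0 t 0 i)) => q.
    by have := is_derive_coord _ _ _ _ _ _ 0 i (hx q I); rewrite p0 mxE.
  by apply: rV2P.
have := minT (T / 2); have -> : 0 < T / 2 by lra.
by move=> /(_ isT (fun u => xc _ _)); lra.
Qed.

(** The pairing of a solution with an adjoint solution is constant. At time 0 it pairs the velocity,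
    a left eigenvector of Y(T), with [z0 0], a right one, and simplicity of the multiplier 1
    excludes the value 0. *)
Lemma velocity_transversal (R : realType) (psi : 'rV[R]_2 -> 'rV[R]_2) x0 z0 (T a : R) :
  C1 psi -> solves_on setT (fun=> psi) x0 -> smallest_period x0 T ->
  (forall t i j, `|linearization psi x0 t i j| <= a) ->
  simple_multiplier (linearization psi x0) T 1 ->
  eigenfunction (adjoint (linearization psi x0)) T 1 z0 ->
  exists2 c, c != 0 & forall t, dot (z0 t) (psi (x0 t)) = c.
Proof.
move=> hpsi hx hT hA [Y [Y0 dY mY]] [hz [t0 zt0] zT].
have hA' := adjoint_bounded R _ a hA.
have hv := velocity_solves_linearization R _ _ hpsi hx.
exists (dot (psi (x0 0)) (z0 0)); last first.
  by move=> t; rewrite (dot_adjoint_cst R _ _ _ hz hv t 0) !dotE; ring.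
have zz : z0 T = z0 0 by have := zT 0; rewrite add0r scale1r.
have xT : x0 T = x0 0 by have [_ /(_ 0)] := hT; rewrite add0r.
apply: (simple_eigenvalue_dot R (Y T)) => //.
- exact: velocity_neq0 hpsi hx hT hA 0.
- apply: contra zt0 => /eqP z00; apply/eqP.
  exact: (lin_solution_eq0 R _ a _ hA' hz 0 t0).
(* By uniqueness the velocity is its initial value times Y(t); at T it returns to the initial
   value. *)
- pose u t := psi (x0 t) - 1 *: (psi (x0 0) *m Y t).
  have hu : solves_on setT (lin (linearization psi x0)) u.
    apply: solves_linB => // t _.
    have H i : is_derive t 1 (fun t => (psi (x0 0) *m Y t) 0 i)
        ((lin (linearization psi x0) t (psi (x0 0) *m Y t)) 0 i).
      under eq_fun do rewrite mulmx2E.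
      have h0 := is_deriveZ (psi (x0 0) 0 0) (is_derive_coord _ _ _ _ _ _ 0 i (dY t)).
      have h1 := is_deriveZ (psi (x0 0) 0 1) (is_derive_coord _ _ _ _ _ _ 1 i (dY t)).
      apply: is_derive_eq (is_deriveD h0 h1) _.
      by rewrite /lin -mulmxA mulmx2E.
    by apply: is_derive_rV2; exact: H.
  have uT : u T = 0.
    apply: (lin_solution_eq0 R _ a _ hA hu 0 T).
    by rewrite /u Y0 mulmx1 scale1r subrr.
  by move/eqP: uT; rewrite /u scale1r subr_eq0 xT => /eqP.
(* Each row of Y is a solution, so its pairing with z0 agrees at T and 0; as z0(T) = z0(0) and Y(0)
   = 1, this is the eigenvector equation for the transpose. *)
- have H i : (z0 0 *m (Y T)^T) 0 i = z0 0 0 i.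
    have hr : solves_on setT (lin (linearization psi x0)) (fun t => row i (Y t)).
      move=> t _.
      have H j : is_derive t 1 (fun t => (row i (Y t)) 0 j)
          ((lin (linearization psi x0) t (row i (Y t))) 0 j).
        under eq_fun do rewrite mxE.
        apply: is_derive_eq (is_derive_coord _ _ _ _ _ _ i j (dY t)) _.
        by rewrite /lin -row_mul [RHS]mxE.
      by apply: is_derive_rV2; exact: H.
    have := dot_adjoint_cst R _ _ _ hz hr T 0.
    rewrite mulmx2E zz Y0 !dotE !mxE => ->.
    by case: (ord2P i) => ->; rewrite /= mulr1 mulr0 ?addr0 ?add0r.
  by apply: rV2P.
Qed.

(** Up to sign this number is the determinant of the pair (z0, z1). If it vanished at some t, z1 - k
    z0 would vanish at t, hence at t + T, where it equals (rho - 1) z1(t). *)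
Lemma perp_dot_neq0 (R : realType) (A : R -> 'M[R]_2) (a T rho : R) (z0 z1 : R -> 'rV[R]_2) :
  (forall t i j, `|A t i j| <= a) -> rho != 1 ->
  eigenfunction A T 1 z0 -> eigenfunction A T rho z1 ->
  forall t, dot (perp (z0 t)) (z1 t) != 0.
Proof.
move=> hA rho1 [h0 [t0 z0t0] z0T] [h1 [t1 z1t1] z1T] t; apply/eqP.
have z0t : z0 t != 0.
  by apply: contra z0t0 => /eqP zt; apply/eqP; exact: lin_solution_eq0 hA h0 t t0 zt.
have z1t : z1 t != 0.
  by apply: contra z1t1 => /eqP zt; apply/eqP; exact: lin_solution_eq0 hA h1 t t1 zt.
rewrite dotE !mxE/= => e.
have N0 : dot (z0 t) (z0 t) != 0.
  apply: contra z0t; rewrite dotE -!expr2 paddr_eq0 ?sqr_ge0// !sqrf_eq0.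
  by move=> /andP[/eqP e0 /eqP e1]; apply/eqP/rV2P; rewrite mxE.
pose k := dot (z0 t) (z1 t) / dot (z0 t) (z0 t).
have zk : z1 t = k *: z0 t.
  apply: rV2P; rewrite mxE /k mulrAC; apply: (canRL (mulfK N0)); rewrite !dotE.
    have := congr1 (fun x => z0 t 0 1 * x) e; rewrite mulr0; lra.
  have := congr1 (fun x => z0 t 0 0 * x) e; rewrite mulr0; lra.
have w0 : z1 (t + T) - k *: z0 (t + T) = 0.
  by apply: (lin_solution_eq0 R _ a _ hA (solves_linB R _ _ _ k h1 h0) t); rewrite zk subrr.
move: w0; rewrite z1T z0T scale1r -zk -{2}(scale1r (z1 t)) -scalerBl => /eqP.
by rewrite scaler_eq0 subr_eq0 (negbTE rho1) (negbTE z1t).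
Qed.

(** * The flow near the cycle *)

Lemma lipschitz_solutions_dist (R : realType) (F : 'rV[R]_2 -> 'rV[R]_2) (L Delta : R)
    (y1 y2 : R -> 'rV[R]_2) (s t : R) : 0 <= L ->
  (forall u v, `|F u - F v| <= L * `|u - v|) ->
  solves_on setT (fun=> F) y1 -> solves_on setT (fun=> F) y2 ->
  `|s - t| <= Delta ->
  `|y1 s - y2 s| <= gronwall_const R L Delta * `|y1 t - y2 t|.
Proof.
move=> L0 hL h1 h2 std.
set C := gronwall_const _ _ _.
pose D t := y1 t - y2 t; pose dD t := F (y1 t) - F (y2 t).
have hD (r : R) : is_derive r 1 D (dD r) by apply: is_deriveB; [exact: h1|exact: h2].
have hdD (r : R) : `|dD r| <= L * `|D r| + 0 by rewrite addr0 hL.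
(* The Lipschitz bound is global, so any threshold above the conclusion will do. *)
have r1 : C * (`|D t| + 0) < C * (`|D t| + 0) + 1 by rewrite ltrDl.
rewrite -[`|y1 t - _|]addr0.
have [st|/ltW ts] := leP s t.
  by apply: (gronwall_bwd R L Delta s t 0 _ D dD L0 _ _ _ _ r1) => //; move: std; rewrite ler_norml; lra.
by apply: (gronwall_fwd R L Delta t s 0 _ D dD L0 _ _ _ _ r1) => //; move: std; rewrite ler_norml; lra.
Qed.

Definition cutoff (R : realType) (psi : 'rV[R]_2 -> 'rV[R]_2) (K : R) (p : 'rV[R]_2) :=
  psi (clamp R K p).

(** Trajectories are normalised at time T instead of 0: [V p 0] is then the point that the flow
    carries to p in time T, which is what membership of p in the image of [Imap] asks for. *)
Lemma cutoff_flow (R : realType) (psi : 'rV[R]_2 -> 'rV[R]_2) (K T : R) :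
  C1 psi -> 0 <= K -> exists2 L, 0 <= L &
    [/\ forall u v, `|cutoff R psi K u - cutoff R psi K v| <= L * `|u - v|,
        forall u v : 'rV[R]_2, `|u| <= K -> `|v| <= K -> `|psi u - psi v| <= L * `|u - v|
      & exists V : 'rV[R]_2 -> R -> 'rV[R]_2, forall p,
        V p T = p /\ solves_on setT (fun=> cutoff R psi K) (V p)].
Proof.
move=> hpsi K0; have [L L0 hL] := C1_lipschitz R psi K hpsi.
have lip u v : `|cutoff R psi K u - cutoff R psi K v| <= L * `|u - v|.
  rewrite (le_trans (hL _ _ (clamp_in _ _ _ K0) (clamp_in _ _ _ K0)))//.
  by rewrite ler_wpM2l// clamp_lipschitz.
exists L => //; split => //.
have bd u : `|cutoff R psi K u| <= L * K + `|psi 0|.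
  rewrite -[cutoff R psi K u](subrK (psi 0)) (le_trans (ler_normD _ _))// lerD2r.
  rewrite (le_trans (hL _ _ (clamp_in _ _ _ K0) _)) ?normr0// subr0.
  by rewrite ler_wpM2l// clamp_in.
have H p : exists v : R -> 'rV[R]_2, v T = p /\ solves_on setT (fun=> cutoff R psi K) v.
  have [y [y0 hy]] := picard R _ L _ p lip bd.
  exists (fun t => y (t + - T)); split; first by rewrite subrr.
  by move=> t _; apply: is_derive_rV2_shift.
by have [V hV] := choice H; exists V.
Qed.

Lemma solves_on_shift (R : realType) (F : 'rV[R]_2 -> 'rV[R]_2) (x : R -> 'rV[R]_2) (s : R) :
  solves_on setT (fun=> F) x -> solves_on setT (fun=> F) (fun t => x (t + s)).
Proof. by move=> h t _; apply: is_derive_rV2_shift; exact: h. Qed.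

Lemma solves_cutoff (R : realType) (psi : 'rV[R]_2 -> 'rV[R]_2) (K : R) (x : R -> 'rV[R]_2) :
  (forall t, `|x t| <= K) -> solves_on setT (fun=> psi) x ->
  solves_on setT (fun=> cutoff R psi K) x.
Proof. by move=> xK h t _; rewrite /cutoff clamp_id//; exact: h. Qed.

(** The coefficient is split off so that the right side has the form of the displacement in [hmap],
    with r explicit. *)
Lemma rV2_orthogonal (R : realType) (z e : 'rV[R]_2) : z != 0 -> dot z e = 0 ->
  e = (dot (perp z) e / enorm (perp z)) *: ((enorm (perp z))^-1 *: perp z).
Proof.
move=> z0 ze.
have N0 : 0 < z 0 0 ^+ 2 + z 0 1 ^+ 2.
  rewrite lt_def addr_ge0 ?sqr_ge0// andbT.
  apply: contra z0; rewrite paddr_eq0 ?sqr_ge0// !sqrf_eq0.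
  by move=> /andP[/eqP e0 /eqP e1]; apply/eqP/rV2P; rewrite mxE.
have pN : dot (perp z) (perp z) = z 0 0 ^+ 2 + z 0 1 ^+ 2 by rewrite dotE !mxE/=; ring.
have sN : enorm (perp z) ^+ 2 = z 0 0 ^+ 2 + z 0 1 ^+ 2.
  by rewrite /enorm sqr_sqrtr ?pN// ltW.
rewrite scalerA -mulrA -invfM -expr2 sN.
rewrite dotE in ze.
apply: rV2P; rewrite !dotE !mxE/= mulrAC; apply: (canRL (mulfK (lt0r_neq0 N0))).
  have := congr1 (fun x => z 0 0 * x) ze; rewrite mulr0; lra.
have := congr1 (fun x => z 0 1 * x) ze; rewrite mulr0; lra.
Qed.

Lemma enorm_le (R : realType) (u : 'rV[R]_2) : enorm u <= 2 * `|u|.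
Proof.
rewrite /enorm -(@ler_pXn2r _ 2)// ?nnegrE ?sqrtr_ge0 ?mulr_ge0//.
rewrite sqr_sqrtr; last by rewrite dotE -!expr2 addr_ge0 ?sqr_ge0.
apply: le_trans (dot_self_ge _ _) _; rewrite exprMn ler_wpM2r ?sqr_ge0//; lra.
Qed.

Lemma enorm_ge (R : realType) (u : 'rV[R]_2) : `|u| <= enorm u.
Proof.
rewrite /enorm -(@ler_pXn2r _ 2)// ?nnegrE ?sqrtr_ge0//.
rewrite sqr_sqrtr; last by rewrite dotE -!expr2 addr_ge0 ?sqr_ge0.
exact: dot_self_le.
Qed.

Lemma dot_le_enorm (R : realType) (u v : 'rV[R]_2) : `|dot u v| <= enorm u * enorm v.
Proof.
rewrite /enorm -(@ler_pXn2r _ 2)// ?nnegrE ?mulr_ge0 ?sqrtr_ge0//.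
have q0 (w : 'rV[R]_2) : 0 <= dot w w by rewrite dotE -!expr2 addr_ge0 ?sqr_ge0.
rewrite exprMn !sqr_sqrtr// real_normK ?num_real//.
have : 0 <= (u 0 0 * v 0 1 - u 0 1 * v 0 0) ^+ 2 by exact: sqr_ge0.
rewrite !dotE; lra.
Qed.

Lemma enorm_perp (R : realType) (z : 'rV[R]_2) : enorm (perp z) = enorm z.
Proof. by rewrite /enorm !dotE !mxE/= mulrNN addrC. Qed.

(** Inside the ball the truncated field is psi, so v is a genuine solution on (-1, T + 1), an open
    interval around [0, T] as [Omega] requires. Cauchy-Schwarz bounds r by the Euclidean length of
    v(0) - x0(t). *)
Lemma cutoff_orbit_in_Imap (R : realType) (psi : 'rV[R]_2 -> 'rV[R]_2) (K T : R)
    (x0 z0 v : R -> 'rV[R]_2) (t : R) : 0 < T ->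
  (forall s, -1 < s < T + 1 -> `|v s| <= K) ->
  solves_on setT (fun=> cutoff R psi K) v ->
  z0 t != 0 -> dot (z0 t) (v 0 - x0 t) = 0 -> enorm (v 0 - x0 t) <= 1 ->
  (\bigcup_(r in `[-1, 1]) Imap psi T x0 z0 t r) (v T).
Proof.
move=> T0 vK hv z0t ze v1.
have e := rV2_orthogonal R _ _ z0t ze.
exists (dot (perp (z0 t)) (v 0 - x0 t) / enorm (perp (z0 t))).
  have P0 : 0 < enorm (perp (z0 t)).
    by rewrite enorm_perp (lt_le_trans _ (enorm_ge _ _))// normr_gt0.
  rewrite /= in_itv/= -ler_norml normrM normfV (gtr0_norm P0) ler_pdivrMr// mul1r.
  by rewrite (le_trans (dot_le_enorm _ _ _))// ler_piMr// ltW.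
exists (-1), (T + 1), v; split => //.
- by rewrite in_itv/=; lra.
- by rewrite in_itv/=; lra.
- move=> s; rewrite /= in_itv/= => sab; have := hv s I.
  by rewrite /cutoff clamp_id// vK.
- by rewrite /hmap -e addrC subrK.
Qed.

(** * The perturbation *)

(** The clipped variable is the parameter e. Continuity within the closed slab 0 <= e <= 1 becomes
    continuity on the whole space, so neighbourhoods at the boundary e = 0 raise no difficulty. *)
Lemma clip_time_continuous (R : realType) (phi : R -> 'rV[R]_2 -> R -> 'rV[R]_2) :
  {within [set p : R * 'rV[R]_2 * R | p.2 \in `[0, 1]],
    continuous (fun p => phi p.1.1 p.1.2 p.2)} ->
  continuous (fun p : R * 'rV[R]_2 * R => phi p.1.1 p.1.2 (clip R 0 1 p.2)).
Proof.
set A := [set p | _] => cphi p.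
pose g (p : R * 'rV[R]_2 * R) := (p.1, clip R 0 1 p.2).
have gA q : A (g q) by rewrite /A/= in_itv/= clip_in.
have cg : {for p, continuous g}.
  apply: (@lipschitz_cont R _ _ g 1) => u v; rewrite mul1r !prod_normE/= ge_max le_max lexx/=.
  by rewrite le_max clip_lipschitz orbT.
move=> U /= hU.
have h := cphi (g p) U hU.
rewrite /nbhs/= -(nbhs_subspace_in (gA p)) in h.
exact: (@filterS _ (nbhs p) _ _ ((fun q => phi q.1.1 q.1.2 (clip R 0 1 q.2)) @^-1` U)
  (fun q hq => hq (gA q)) (cg _ h)).
Qed.

(** Both parts follow from compactness of the box |s| <= S, |u| <= K, 0 <= e <= 1; in the second
    only the reference point (s, u, 0) has to lie in it. *)
Lemma forcing_uniform (R : realType) (phi : R -> 'rV[R]_2 -> R -> 'rV[R]_2) (S K : R) :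
  0 <= S -> 0 <= K ->
  {within [set p : R * 'rV[R]_2 * R | p.2 \in `[0, 1]],
    continuous (fun p => phi p.1.1 p.1.2 p.2)} ->
  (exists2 B, 0 <= B & forall s (u : 'rV[R]_2) e, `|s| <= S -> `|u| <= K -> 0 <= e <= 1 ->
    `|phi s u e| <= B) /\
  (forall eta, 0 < eta -> exists2 delta, 0 < delta &
    forall s s' (u u' : 'rV[R]_2) e, `|s| <= S -> `|u| <= K ->
      `|s - s'| < delta -> `|u - u'| < delta -> 0 <= e <= 1 -> e < delta ->
      `|phi s u 0 - phi s' u' e| < eta).
Proof.
move=> S0 K0 /clip_time_continuous; set f := (fun p => _) => cf.
pose Q : set (R * 'rV[R]_2 * R) := ((`[- S, S]%classic `*` [set u | `|u| <= K]) `*` `[0, 1]%classic).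
have cQ : compact Q.
  by apply: compact_setX; [apply: compact_setX; [exact: segment_compact|exact: compact_ball]|exact: segment_compact].
have fE s (u : 'rV[R]_2) e : 0 <= e <= 1 -> f (s, u, e) = phi s u e.
  by move=> e01; rewrite /f/= clip_id.
have Q0 : Q !=set0.
  exists (0, 0, 0); rewrite /Q/=; split; first split => /=.
  - by rewrite in_itv/=; lra.
  - by rewrite normr0.
  - by rewrite in_itv/= lexx ler01.
have cn : continuous (fun p => `|f p|).
  by move=> p; apply: (@continuous_comp _ _ _ f (fun v => `|v|) p (cf p)); exact: norm_continuous.
split.
  have [c _ hc] := compact_EVT_max Q0 cQ (continuous_subspaceT cn).
  exists `|f c| => // s u e sS uK e01; rewrite -fE//; apply: hc.
  rewrite inE /Q/=; split; first by split => //=; rewrite in_itv/= -ler_norml.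
  by rewrite /= in_itv.
move=> eta eta0; have [d d0 hd] := compact_uniformly_continuous R _ _ f Q cQ (fun p _ => cf p) eta eta0.
exists d => // s s' u u' e sS uK ss uu e01 ed.
rewrite -!fE// ?lexx ?ler01//; apply: hd.
  by split; [split => //=; rewrite in_itv/= -ler_norml|rewrite /= in_itv/= lexx ler01].
split; first by split; rewrite -ball_normE.
by rewrite -ball_normE/= sub0r normrN; case/andP: e01 => e0 _; rewrite ger0_norm.
Qed.

Definition perturbed (R : realType) (psi : 'rV[R]_2 -> 'rV[R]_2)
  (phi : R -> 'rV[R]_2 -> R -> 'rV[R]_2) (e : R) : R -> 'rV[R]_2 -> 'rV[R]_2 :=
  fun t u => psi u + e *: phi t u e.

(** Gronwall's inequality over one period, started from the small value D(0) and with forcing at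
    most e B, gives closeness on [0, T]; periodicity extends it to all s. *)
Lemma perturbed_close (R : realType) (psi : 'rV[R]_2 -> 'rV[R]_2) (phi : R -> 'rV[R]_2 -> R -> 'rV[R]_2)
    (T theta0 K L B : R) (x0 : R -> 'rV[R]_2) (x : R -> R -> 'rV[R]_2) :
  0 < T -> 0 <= L -> 0 <= B ->
  (forall t, `|x0 t| <= K - 1) ->
  (forall u v : 'rV[R]_2, `|u| <= K -> `|v| <= K -> `|psi u - psi v| <= L * `|u - v|) ->
  (forall s (u : 'rV[R]_2) e, `|s| <= T + `|theta0| -> `|u| <= K -> 0 <= e <= 1 ->
    `|phi s u e| <= B) ->
  solves_on setT (fun=> psi) x0 -> periodic x0 T ->
  (\forall e \near 0^'+, solves_on setT (perturbed R psi phi e) (x e) /\ periodic (x e) T) ->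
  x e (0 - theta0) @[e --> 0^'+] --> x0 0 ->
  forall eta, 0 < eta -> \forall e \near 0^'+, forall s, `|x e (s - theta0) - x0 s| <= eta.
Proof.
move=> T0 L0 B0 x0K hL hB hx0 x0T hx x00 eta eta0.
set C := gronwall_const R L T.
have C1 : 1 <= C by apply: gronwall_const_ge1 => //; exact: ltW.
have C0 : 0 < C by lra.
(* Staying at most 1/2 keeps D below the threshold 1, under which x_e remains in the ball of radius
   K because |x0| <= K - 1. *)
pose m := Num.min eta (1 / 2).
have m0 : 0 < m by rewrite lt_min eta0/=; lra.
have m1 : m <= 1 / 2 by rewrite ge_min lexx orbT.
have meta : m <= eta by rewrite ge_min lexx.
have mC : 0 < m / (2 * C) by rewrite divr_gt0// mulr_gt0.
have mB : 0 < m / (2 * C) / (B + 1) by rewrite divr_gt0//; lra.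
move/cvgrPdist_lt : x00 => /(_ _ mC) x00.
near=> e.
have e0 : 0 < e by near: e; exact: nbhs_right_gt.
have e1 : e <= 1 by near: e; apply: nbhs_right_le.
have eB : e < m / (2 * C) / (B + 1) by near: e; exact: nbhs_right_lt.
have d0 : `|x0 0 - x e (0 - theta0)| < m / (2 * C) by near: e.
have [hxe xeT] : solves_on setT (perturbed R psi phi e) (x e) /\ periodic (x e) T by near: e.
pose D s := x e (s - theta0) - x0 s.
have DT : periodic D T by move=> s; rewrite /D x0T addrAC xeT.
move=> s; rewrite -/(D s).
have [t tT ->] := periodic_reduce R _ D T T0 DT s.
move: tT; rewrite in_itv/= => /andP[t0 tT].
pose dD s := perturbed R psi phi e (s - theta0) (x e (s - theta0)) - psi (x0 s).
have small : C * (`|D 0| + e * B) <= m.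
  rewrite distrC in d0.
  have h : e * B <= m / (2 * C).
    rewrite ltr_pdivlMr in eB; last by lra.
    by apply: le_trans (ltW eB); rewrite ler_pM2l//; lra.
  have -> : m = C * (m / (2 * C) + m / (2 * C)) by field; rewrite gt_eqF.
  by rewrite ler_pM2l// lerD// ltW.
apply: (le_trans _ meta); apply: (le_trans _ (small)).
apply: (gronwall_fwd R L T 0 t (e * B) 1 D dD) => //.
- by lra.
- by rewrite mulr_ge0// ltW.
- move=> r _; apply: is_deriveB; last exact: hx0.
  by apply: is_derive_rV2_shift; exact: hxe.
- move=> r /andP[r0 rt] Dr.
  have xK : `|x e (r - theta0)| <= K.
    have -> : x e (r - theta0) = x0 r + D r by rewrite /D [RHS]addrC subrK.
    by rewrite (le_trans (ler_normD _ _))//; have := x0K r; lra.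
  have -> : dD r = (psi (x e (r - theta0)) - psi (x0 r)) + e *: phi (r - theta0) (x e (r - theta0)) e.
    by rewrite /dD /perturbed addrAC.
  rewrite (le_trans (ler_normD _ _))// lerD//.
    by apply: hL => //; have := x0K r; lra.
  rewrite normrZ gtr0_norm// ler_pM2l// hB//; last by rewrite ltW.
  rewrite (le_trans (ler_normB _ _))// lerD2r ger0_norm//; lra.
- by apply: le_lt_trans small _; lra.
Unshelve. all: by end_near. Qed.

Lemma dot_le_bound (R : realType) (u v : 'rV[R]_2) (a b : R) :
  `|u| <= a -> `|v| <= b -> `|dot u v| <= 2 * a * b.
Proof.
move=> ua vb; apply: le_trans (dot_le _ _ _) _.
by apply: ler_pM; rewrite ?mulr_ge0// ler_wpM2l.
Qed.

(** The adjoint equation cancels the linear part of E', so only the deviation from the linearized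
    equation is left. The shift s allows trajectories compared with x0 at a translated time. *)
Lemma is_derive_pairing (R : realType) (A : R -> 'M[R]_2) (z E : R -> 'rV[R]_2) (t s : R) dE :
  solves_on setT (lin (adjoint A)) z -> is_derive t 1 E dE ->
  is_derive t 1 (fun t => dot (z (t + s)) (E t)) (dot (z (t + s)) (dE - E t *m A (t + s))).
Proof.
move=> hz hE.
have hzs := is_derive_rV2_shift _ z s t _ (hz (t + s) I).
apply: is_derive_eq (is_derive_dot _ _ _ _ _ _ hzs hE) _.
by rewrite /lin /adjoint dot_adjoint dotBr addrC.
Qed.

(** * Backward flow near the cycle and the phase condition *)

Section LimitCycle.
Context (R : realType) (psi : 'rV[R]_2 -> 'rV[R]_2) (x0 z0 : R -> 'rV[R]_2) (T K L : R)
  (V : 'rV[R]_2 -> R -> 'rV[R]_2).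
Hypotheses (T0 : 0 < T) (L0 : 0 <= L) (x0K : forall t, `|x0 t| <= K - 1)
  (lipG : forall u v, `|cutoff R psi K u - cutoff R psi K v| <= L * `|u - v|)
  (VT : forall p, V p T = p)
  (Vsol : forall p, solves_on setT (fun=> cutoff R psi K) (V p))
  (x0sol : solves_on setT (fun=> psi) x0) (x0T : periodic x0 T).

(** The length T + 1 is the largest distance from the normalisation time T to a point of
    [-1, T + 1]. *)
Let C := gronwall_const R L (T + 1).

Lemma flow_close p q s : -1 <= s <= T + 1 -> `|V p s - V q s| <= C * `|p - q|.
Proof.
have T1 := T0; move=> hs; rewrite -{2}(VT p) -{2}(VT q).
by apply: (lipschitz_solutions_dist R _ L (T + 1) _ _ s T L0 lipG) => //; rewrite ler_norml; lra.
Qed.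

Lemma flow_near_orbit p t s : -1 <= s <= T + 1 ->
  `|V p s - x0 (s + t)| <= C * `|p - x0 t|.
Proof.
have T1 := T0; move=> hs; have -> : x0 t = x0 (T + t) by rewrite addrC x0T.
rewrite -{2}(VT p).
apply: (lipschitz_solutions_dist R _ L (T + 1) _ (fun s => x0 (s + t)) s T L0 lipG) => //.
  apply: solves_on_shift; apply: solves_cutoff => // r; have := x0K r; lra.
by rewrite ler_norml; lra.
Qed.

Context (Z c B : R).
Hypotheses (lipK : forall u v : 'rV[R]_2, `|u| <= K -> `|v| <= K -> `|psi u - psi v| <= L * `|u - v|)
  (z0Z : forall t, `|z0 t| <= Z) (z0c : forall t, dot (z0 t) (psi (x0 t)) = c)
  (x0B : forall t, `|psi (x0 t)| <= B).

Let Z0 : 0 <= Z. Proof. exact: le_trans (z0Z 0). Qed.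
Let B0 : 0 <= B. Proof. exact: le_trans (x0B 0). Qed.
Let C0 : 0 <= C.
Proof. by apply: le_trans (gronwall_const_ge1 R L (T + 1) L0 _) => //; have := T0; lra. Qed.

Lemma orbit_lipschitz s t : `|x0 s - x0 t| <= B * `|s - t|.
Proof.
wlog st : s t / s <= t.
  by move=> H; have [/H//|/ltW/H] := leP s t; rewrite distrC [`|t - s|]distrC.
rewrite distrC [`|s - t|]distrC [`|t - s|]ger0_norm ?subr_ge0//.
by apply: (mvt_rV2_le R x0 (fun t => psi (x0 t))) => // r _; exact: x0sol.
Qed.

(** First-order Taylor estimate: the linear coefficient <z0(t), x0'(t)> is c, and the Lipschitz
    bounds of psi and x0 give the quadratic remainder. *)
Lemma orbit_increment t s :
  `|dot (z0 t) (x0 (t + s) - x0 t) - c * s| <= 2 * Z * L * B * s ^+ 2.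
Proof.
pose f r := dot (z0 t) (x0 (r + t)) - c * r.
pose df r := dot (z0 t) (psi (x0 (r + t))) - c.
have hf (r : R) : is_derive r 1 f (df r).
  have h1 := is_derive_rV2_shift _ x0 t r _ (x0sol (r + t) I).
  have h2 := is_derive_dot _ _ _ _ _ _ (is_derive_cst (z0 t) r (1:R)) h1.
  have h3 := is_deriveZ c (is_derive_id r (1:R)).
  apply: is_derive_eq (is_deriveB h2 h3) _.
  by rewrite /df dotE !mxE !mul0r !add0r /GRing.scale/= mulr1.
have hdf (r : R) : `|r| <= `|s| -> `|df r| <= 2 * Z * L * B * `|s|.
  move=> rs; rewrite /df -(z0c t) -dotBr.
  have K1 q : `|x0 q| <= K by have := x0K q; lra.
  have h1 := lipK _ _ (K1 (r + t)) (K1 t).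
  have h2 := orbit_lipschitz (r + t) t; rewrite addrK in h2.
  have h3 : `|psi (x0 (r + t)) - psi (x0 t)| <= L * (B * `|s|).
    apply: le_trans h1 _; rewrite ler_wpM2l// (le_trans h2)// ler_wpM2l//.
  have -> : 2 * Z * L * B * `|s| = 2 * Z * (L * (B * `|s|)) by ring.
  exact: dot_le_bound.
have -> : dot (z0 t) (x0 (t + s) - x0 t) - c * s = f s - f 0.
  by rewrite /f dotBr mulr0 subr0 add0r [s + t]addrC; ring.
have -> : 2 * Z * L * B * s ^+ 2 = 2 * Z * L * B * `|s| * `|s|.
  by rewrite -(real_normK (num_real s)) expr2 mulrA.
have [s0|s0] := leP 0 s.
  rewrite [X in _ * X](_ : _ = s - 0); last by rewrite ger0_norm// subr0.
  apply: mvt_norm_le => // r /andP[r0 rs].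
  by apply: hdf; rewrite !ger0_norm// ltW.
rewrite distrC [X in _ * X](_ : _ = 0 - s); last by rewrite ltr0_norm// sub0r.
apply: mvt_norm_le => //; first exact: ltW.
by move=> r /andP[r0 rs]; apply: hdf; rewrite !ltr0_norm// lerN2 ltW.
Qed.

(** The bound 1/2 keeps the whole orbit in the ball of radius K, and as the Euclidean norm is at
    most twice the max norm it puts the point at time 0 at Euclidean distance at most 1 from
    x0(t). *)
Lemma flow_in_Imap t p : z0 t != 0 -> C * `|p - x0 t| <= 1 / 2 ->
  dot (z0 t) (V p 0 - x0 t) = 0 ->
  (\bigcup_(r in `[-1, 1]) Imap psi T x0 z0 t r) p.
Proof.
have T1 := T0; move=> z0t pC pz; rewrite -[X in _ X](VT p).
apply: (cutoff_orbit_in_Imap R psi K) => //.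
- move=> s hs; rewrite -[V p s](subrK (x0 (s + t))) (le_trans (ler_normD _ _))//.
  have h1 : `|V p s - x0 (s + t)| <= C * `|p - x0 t| by apply: flow_near_orbit; lra.
  have := x0K (s + t); lra.
- apply: le_trans (enorm_le _ _) _.
  have := flow_near_orbit p t 0; rewrite add0r => H.
  have : `|V p 0 - x0 t| <= C * `|p - x0 t| by apply: H; lra.
  lra.
Qed.

(** The pairing of z0 with [E] vanishes at time 0 by the phase condition and equals <z0(t), p -
    x0(t)> at time T. Both trajectories follow the same autonomous field, so between these times it
    changes only by the linearization error. *)
Lemma section_pairing_le (eta d : R) t p : 0 <= eta ->
  (forall p D : 'rV[R]_2, `|p| <= K -> `|D| < d ->
    `|psi (p + D) - psi p - D *m jacobian psi p| <= eta * `|D|) ->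
  solves_on setT (lin (adjoint (linearization psi x0))) z0 -> periodic z0 T ->
  C * `|p - x0 t| < d -> C * `|p - x0 t| <= 1 ->
  dot (z0 t) (V p 0 - x0 t) = 0 ->
  `|dot (z0 t) (p - x0 t)| <= 2 * Z * (eta * (C * `|p - x0 t|)) * T.
Proof.
have T1 := T0; move=> eta0 hlin hz z0T pd p1 pz.
pose E s := V p s - x0 (s + t).
pose dE s := cutoff R psi K (V p s) - psi (x0 (s + t)).
have hE (s : R) : is_derive s 1 E (dE s).
  apply: is_deriveB; first exact: Vsol.
  by apply: is_derive_rV2_shift; exact: x0sol.
pose f s := dot (z0 (s + t)) (E s).
have -> : dot (z0 t) (p - x0 t) = f T - f 0.
  by rewrite /f /E !add0r pz subr0 VT [T + t]addrC z0T x0T.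
rewrite -[X in _ * X]subr0.
apply: (mvt_norm_le R f (fun s => dot (z0 (s + t)) (dE s - E s *m linearization psi x0 (s + t))) 0 T) => //.
- by rewrite ltW.
- by move=> s _; apply: is_derive_pairing.
move=> s hs; apply: dot_le_bound => //.
have Es : `|E s| <= C * `|p - x0 t| by apply: flow_near_orbit; lra.
have x0s := x0K (s + t).
have VE : V p s = x0 (s + t) + E s by rewrite /E [RHS]addrC subrK.
have VK : `|V p s| <= K.
  by rewrite VE (le_trans (ler_normD _ _))//; lra.
rewrite /dE /cutoff clamp_id// VE.
apply: le_trans (hlin _ _ _ _) _; [lra|exact: le_lt_trans pd|].
by rewrite ler_wpM2l.
Qed.

Context (xe : R -> 'rV[R]_2) (theta0 kappa : R).
Hypotheses (xec : continuous xe) (xe_close : forall s, `|xe (s - theta0) - x0 s| <= kappa).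

(* It vanishes when the backward orbit of xe (t - theta) reaches, after time T,
   the line through x0 t orthogonal to z0 t, that is the image of hmap. *)
Definition phase_defect t theta : R := dot (z0 t) (V (xe (t - theta)) 0 - x0 t).

(** The backward orbit of xe(t - theta) ends within C kappa of x0(t + theta0 - theta), and
    [orbit_increment] evaluates the pairing there. *)
Lemma phase_defect_approx t theta :
  `|phase_defect t theta - c * (theta0 - theta)| <=
    2 * Z * C * kappa + 2 * Z * L * B * (theta0 - theta) ^+ 2.
Proof.
have T1 := T0.
have h1 := orbit_increment t (theta0 - theta).
have h2 : `|dot (z0 t) (V (xe (t - theta)) 0 - x0 (t + (theta0 - theta)))| <= 2 * Z * C * kappa.
  have -> : 2 * Z * C * kappa = 2 * Z * (C * kappa) by ring.
  apply: dot_le_bound => //.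
  have := flow_near_orbit (xe (t - theta)) (t + (theta0 - theta)) 0.
  rewrite add0r => H; apply: le_trans (H _) _; first by lra.
  rewrite ler_wpM2l//; have := xe_close (t + (theta0 - theta)).
  by have -> : t + (theta0 - theta) - theta0 = t - theta by ring.
apply: le_trans (lerD h2 h1); apply: le_trans (ler_normD _ _).
by rewrite /phase_defect !dotBr le_eqVlt; apply/orP; left; apply/eqP; congr `| _ |; ring.
Qed.

Lemma phase_defect_continuous t : continuous (phase_defect t).
Proof.
move=> theta; apply/cvgrPdist_lt => e e0.
have P : 0 < 2 * Z * C + 1 by rewrite ltr_wpDl// mulr_ge0// mulr_ge0.
have h : {for theta, continuous (fun r => xe (t - r))}.
  apply: (@continuous_comp _ _ _ (fun r => t - r) xe); last exact: xec.
  by apply: (@lipschitz_cont R R R _ 1) => u v; rewrite mul1r opprB addrC subrKA distrC.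
move/cvgrPdist_lt : h => /(_ _ (divr_gt0 e0 P)).
apply: filterS => r hr.
have -> : phase_defect t theta - phase_defect t r =
    dot (z0 t) (V (xe (t - theta)) 0 - V (xe (t - r)) 0).
  by rewrite /phase_defect !dotBr; ring.
have T1 := T0.
have h0 : (-1 : R) <= 0 <= T + 1 by apply/andP; split; lra.
have h1 := flow_close (xe (t - theta)) (xe (t - r)) 0 h0.
apply: (@le_lt_trans _ _ ((2 * Z * C + 1) * `|xe (t - theta) - xe (t - r)|)).
  by rewrite mulrDl mul1r ler_wpDr// -[2 * Z * C * _]mulrA dot_le_bound.
by rewrite -ltr_pdivlMl// mulrC.
Qed.

Context (delta : R).
Hypotheses (delta0 : 0 < delta) (c0 : c != 0)
  (delta_small : 2 * Z * L * B * delta <= `|c| / 2).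

(** By [delta_small] the quadratic error is at most half of the linear term; moving it to the left
    doubles 2 Z C kappa. *)
Lemma phase_defect_zero_close t theta : `|theta - theta0| <= delta ->
  phase_defect t theta = 0 -> `|c| * `|theta - theta0| <= 4 * Z * C * kappa.
Proof.
move=> th h0; have := phase_defect_approx t theta; rewrite h0 sub0r normrN normrM.
rewrite [`|theta0 - _|]distrC => h1.
have h2 : 2 * Z * L * B * (theta0 - theta) ^+ 2 <= `|c| / 2 * `|theta - theta0|.
  rewrite -(real_normK (num_real _)) distrC expr2 mulrA ler_wpM2r//.
  by apply: le_trans delta_small; rewrite ler_wpM2l// !mulr_ge0.
by lra.
Qed.

(** At theta0 - delta and theta0 + delta the linear term dominates the errors, so the defect has
    opposite signs there; which end is positive depends on the sign of c. *)
Lemma phase_defect_zero_exists t : 4 * Z * C * kappa < `|c| * delta ->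
  exists2 theta, `|theta - theta0| <= delta & phase_defect t theta = 0.
Proof.
move=> small.
have hd : 2 * Z * L * B * delta ^+ 2 <= `|c| / 2 * delta.
  by rewrite expr2 mulrA ler_wpM2r// ltW.
have hm := phase_defect_approx t (theta0 - delta).
have hp := phase_defect_approx t (theta0 + delta).
have e1 : theta0 - (theta0 - delta) = delta by ring.
have e2 : theta0 - (theta0 + delta) = - delta by ring.
rewrite e1 in hm; rewrite e2 sqrrN in hp.
have d1 := delta0; have ab : theta0 - delta <= theta0 + delta by lra.
have [|theta] := IVT (v := 0) ab (continuous_subspaceT (phase_defect_continuous t)).
  have X : 2 * Z * C * kappa + 2 * Z * L * B * delta ^+ 2 < `|c| * delta by lra.
  move: (le_lt_trans hm X) (le_lt_trans hp X); rewrite !ltr_norml mulrN opprK.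
  rewrite ge_min le_max .
  move: (phase_defect _ _) (phase_defect _ _) => gm gp /andP[hm1 hm2] /andP[hp1 hp2].
  have [c_gt|c_lt] := ltP 0 c.
    rewrite (gtr0_norm c_gt) in hm1 hm2 hp1 hp2.
    by apply/andP; split; apply/orP; [right|left]; lra.
  rewrite (ler0_norm c_lt) in hm1 hm2 hp1 hp2.
  by apply/andP; split; apply/orP; [left|right]; lra.
by rewrite in_itv/= => th e; exists theta => //; rewrite ler_norml; lra.
Qed.
End LimitCycle.

(** * Displacement asymptotics *)

Lemma Rintegral_FTC (R : realType) (f F : R -> R) (a b : R) : a < b -> continuous f ->
  (forall t : R, is_derive t 1 F (f t)) ->
  \int[lebesgue_measure]_(x in `[a, b]) f x = F b - F a.
Proof.
move=> ab cf hF; rewrite /Rintegral.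
have cF : continuous F by move=> t; exact: derive_cont (hF t).
have H : derivable_oo_LRcontinuous F a b.
  split; first by move=> x _; case: (hF x).
    by apply: cvg_at_right_filter; exact: cF.
  by apply: cvg_at_left_filter; exact: cF.
rewrite (continuous_FTC2 ab (continuous_subspaceT cf) H)//.
by move=> x _; rewrite derive1E; case: (hF x).
Qed.

Lemma dot_continuous (R : realType) (u v : R -> 'rV[R]_2) :
  continuous u -> continuous v -> continuous (fun t => dot (u t) (v t)).
Proof.
move=> cu cv t; under eq_fun do rewrite dotE.
by apply: cvgD; apply: cvgM; apply: coord_cont.
Qed.

Lemma forcing_along_continuous (R : realType) (phi : R -> 'rV[R]_2 -> R -> 'rV[R]_2)
    (x0 : R -> 'rV[R]_2) (theta : R) :
  {within [set p : R * 'rV[R]_2 * R | p.2 \in `[0, 1]],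
    continuous (fun p => phi p.1.1 p.1.2 p.2)} ->
  continuous x0 -> continuous (fun t => phi (t - theta) (x0 t) 0).
Proof.
move=> /clip_time_continuous cphi cx0 t.
have cl : clip R 0 1 0 = 0 by rewrite clip_id// lexx ler01.
have -> : (fun t => phi (t - theta) (x0 t) 0) =
    (fun p : R * 'rV[R]_2 * R => phi p.1.1 p.1.2 (clip R 0 1 p.2)) \o
    (fun t => ((t - theta, x0 t), 0)).
  by apply/funext => s /=; rewrite cl.
apply: continuous_comp; last exact: cphi.
have h1 : s - theta @[s --> t] --> t - theta by apply: cvgB; [exact: cvg_id|exact: cvg_cst].
exact: (cvg_pair (cvg_pair h1 (cx0 t)) (cvg_cst 0)).
Qed.

(** Writing [f1] as an increment of a differentiable function lets the mean value inequality replace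
    estimates of integrals. *)
Lemma f1_primitive (R : realType) (phi : R -> 'rV[R]_2 -> R -> 'rV[R]_2) (T theta : R)
    (x0 z1 : R -> 'rV[R]_2) : 0 < T ->
  {within [set p : R * 'rV[R]_2 * R | p.2 \in `[0, 1]],
    continuous (fun p => phi p.1.1 p.1.2 p.2)} ->
  continuous x0 -> continuous z1 ->
  exists Q : R -> R,
    (forall s : R, is_derive s 1 Q (dot (z1 s) (phi (s - theta) (x0 s) 0))) /\
    forall s, f1 T phi x0 z1 theta s = Q s - Q (s - T).
Proof.
move=> T0 cphi cx cz.
have cq := dot_continuous R _ _ cz (forcing_along_continuous R phi x0 theta cphi cx).
have [Q [_ hQ]] := continuous_primitive R _ cq.
exists Q; split => // s; rewrite /f1.
by apply: Rintegral_FTC => //; rewrite gtrBl.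
Qed.

(* With D(s) = xe(s - theta) - x0(s), which is T-periodic, <z1, D>' equals
   e <z1, phi> up to small terms; integrating over a period, the left side is
   (1 - 1/rho) <z1(t), D(t)> because z1 is multiplied by rho over a period. *)
Lemma displacement_pairing_le (R : realType) (psi : 'rV[R]_2 -> 'rV[R]_2)
    (phi : R -> 'rV[R]_2 -> R -> 'rV[R]_2) (T rho K L B Z eta d e theta theta0 t : R)
    (x0 z1 xe : R -> 'rV[R]_2) :
  0 < T -> 0 <= L -> 0 <= eta -> 0 <= e -> 0 <= B ->
  solves_on setT (fun=> psi) x0 -> periodic x0 T -> (forall s, `|x0 s| <= K - 1) ->
  (forall u v : 'rV[R]_2, `|u| <= K -> `|v| <= K -> `|psi u - psi v| <= L * `|u - v|) ->
  (forall p D : 'rV[R]_2, `|p| <= K -> `|D| < d ->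
    `|psi (p + D) - psi p - D *m jacobian psi p| <= eta * `|D|) ->
  solves_on setT (lin (adjoint (linearization psi x0))) z1 ->
  (forall s, z1 (s + T) = rho *: z1 s) -> rho != 0 ->
  (forall s, t - T <= s <= t -> `|z1 s| <= Z) ->
  {within [set p : R * 'rV[R]_2 * R | p.2 \in `[0, 1]],
    continuous (fun p => phi p.1.1 p.1.2 p.2)} ->
  solves_on setT (perturbed R psi phi e) xe -> periodic xe T ->
  (forall s, `|xe (s - theta) - x0 s| < d) -> (forall s, `|xe (s - theta) - x0 s| <= 1) ->
  (forall s, t - T <= s <= t -> `|phi (s - theta) (xe (s - theta)) e| <= B) ->
  (forall s, t - T <= s <= t ->
    `|phi (s - theta) (xe (s - theta)) e - phi (s - theta0) (x0 s) 0| <= eta) ->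
  `|(1 - rho^-1) * dot (z1 t) (xe (t - theta) - x0 t) - e * f1 T phi x0 z1 theta0 t| <=
    2 * Z * (eta * (gronwall_const R L T * (`|xe (t - theta) - x0 t| + e * B)) + e * eta) * T.
Proof.
move=> T0 L0 eta0 e0 B0 hx0 x0T x0K lipK hlin hz1 z1T rho0 z1Z cphi hxe xeT Dd D1 phiB phieta.
set C := gronwall_const R L T.
pose D s := xe (s - theta) - x0 s.
pose dD s := perturbed R psi phi e (s - theta) (xe (s - theta)) - psi (x0 s).
have hD (s : R) : is_derive s 1 D (dD s).
  apply: is_deriveB; last exact: hx0.
  by apply: is_derive_rV2_shift; exact: hxe.
have DT : D (t - T) = D t.
  by rewrite -[RHS](congr1 D (subrK T t)) /D x0T [t - T + T - theta]addrAC xeT.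
have xE s : xe (s - theta) = x0 s + D s by rewrite /D [RHS]addrC subrK.
have x0K' s : `|x0 s| <= K by have := x0K s; lra.
have xK s : `|xe (s - theta)| <= K.
  by rewrite xE (le_trans (ler_normD _ _))//; have := x0K s; have := D1 s; rewrite -/(D s); lra.
have dDE s : dD s = (psi (x0 s + D s) - psi (x0 s)) + e *: phi (s - theta) (xe (s - theta)) e.
  by rewrite /dD /perturbed -xE addrAC.
(* Periodicity moves the value at t to the start t - T of the window, from which forward Gronwall
   reaches every s. *)
have Dle s : t - T <= s <= t -> `|D s| <= C * (`|D t| + e * B).
  move=> /andP[s1 s2]; rewrite -DT.
  apply: (gronwall_fwd R L T (t - T) s (e * B) (C * (`|D (t - T)| + e * B) + 1) D dD) => //.
  - by lra.
  - by rewrite mulr_ge0.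
  - move=> r /andP[r1 r2] _; rewrite dDE (le_trans (ler_normD _ _))// lerD//.
      by rewrite -xE; exact: lipK.
    by rewrite normrZ ger0_norm// ler_wpM2l// phiB// r1 (le_trans r2).
  - by rewrite ltrDl.
have cz1 : continuous z1 by exact: solution_cont hz1.
have cx0 : continuous x0 by exact: solution_cont hx0.
have [Q [hQ ->]] := f1_primitive R phi T theta0 x0 z1 T0 cphi cx0 cz1.
(* The increment of [f] over the window is the quantity to bound, and its derivative contains only
   error terms; [s + 0] fits the shifted form of [is_derive_pairing]. *)
pose f s := dot (z1 (s + 0)) (D s) - e * Q s.
have -> : (1 - rho^-1) * dot (z1 t) (xe (t - theta) - x0 t) - e * (Q t - Q (t - T)) =
    f t - f (t - T).
  rewrite /f DT !addr0 -/(D t).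
  have -> : dot (z1 t) (D t) = rho * dot (z1 (t - T)) (D t).
    by rewrite -dotZl -z1T subrK.
  by field.
rewrite [leRHS](_ : _ = 2 * Z * (eta * (C * (`|D t| + e * B)) + e * eta) * (t - (t - T))); last first.
  by rewrite /D; ring.
apply: (mvt_norm_le R f (fun s => dot (z1 (s + 0)) (dD s - D s *m linearization psi x0 (s + 0))
  - e * dot (z1 s) (phi (s - theta0) (x0 s) 0)) (t - T) t).
- by lra.
- move=> s _; apply: is_deriveB; exact: is_derive_pairing.
move=> s /andP[s1 s2].
have st : t - T <= s <= t by rewrite !ltW.
rewrite addr0 -dotZr -dotBr; apply: dot_le_bound; first exact: z1Z.
rewrite dDE.
have -> : psi (x0 s + D s) - psi (x0 s) + e *: phi (s - theta) (xe (s - theta)) e -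
    D s *m linearization psi x0 s - e *: phi (s - theta0) (x0 s) 0 =
  (psi (x0 s + D s) - psi (x0 s) - D s *m linearization psi x0 s) +
   e *: (phi (s - theta) (xe (s - theta)) e - phi (s - theta0) (x0 s) 0).
  have zid (v w y z : 'rV[R]_2) : v + w - y - z = v - y + (w - z).
    by apply/rowP => i; rewrite !mxE; ring.
  by rewrite scalerBr zid.
rewrite (le_trans (ler_normD _ _))// lerD//.
  apply: le_trans (hlin _ _ (x0K' s) (Dd s)) _.
  by rewrite ler_wpM2l// Dle.
by rewrite normrZ ger0_norm// ler_wpM2l// phieta.
Qed.

Lemma uniform_cvgP (R : realType) (A : set R) (F : R -> R -> R) (g : R -> R) :
  (forall w, 0 < w -> \forall e \near 0^'+, forall t, A t -> `|F e t - g t| < w) ->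
  {uniform A, F @ 0^'+ --> g}.
Proof.
move=> h; rewrite restricted_cvgE => P /uniform_nbhs[E [entE EP]].
have [w /= w0 hw] : filter_from [set e : R | 0 < e]
    (fun e => [set xy : R * R | ball xy.1 e xy.2]) E.
  by move: entE; rewrite -entourage_ballE.
apply: filterS (h w w0) => e he; apply: EP => t At; apply: hw => /=.
by rewrite -ball_normE/= distrC he.
Qed.

Lemma enormD (R : realType) (u v : 'rV[R]_2) : enorm (u + v) <= enorm u + enorm v.
Proof.
have q0 (w : 'rV[R]_2) : 0 <= dot w w by rewrite dotE -!expr2 addr_ge0 ?sqr_ge0.
have e2 (w : 'rV[R]_2) : enorm w ^+ 2 = dot w w by rewrite /enorm sqr_sqrtr.
rewrite -(@ler_pXn2r _ 2)// ?nnegrE ?addr_ge0 ?sqrtr_ge0// e2 sqrrD !e2.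
have := le_trans (ler_norm _) (dot_le_enorm _ u v).
by rewrite !dotE !mxE; lra.
Qed.

Lemma enormZ (R : realType) (k : R) (u : 'rV[R]_2) : enorm (k *: u) = `|k| * enorm u.
Proof. by rewrite /enorm dotZr dotZl mulrA -expr2 sqrtrM ?sqr_ge0// sqrtr_sqr. Qed.

(* Cramer's rule for D in terms of its products with z0 and z1. *)
Lemma enorm_cramer (R : realType) (z0 z1 D : 'rV[R]_2) :
  `| `|dot (perp z0) z1| * enorm D - enorm z0 * `|dot z1 D| | <= `|dot z0 D| * enorm z1.
Proof.
have e : dot (perp z0) z1 *: D = dot z1 D *: perp z0 - dot z0 D *: perp z1.
  by apply: rV2P; rewrite !mxE !dotE !mxE/=; ring.
have h1 : `|dot (perp z0) z1| * enorm D <= enorm z0 * `|dot z1 D| + `|dot z0 D| * enorm z1.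
  rewrite -enormZ e -scaleNr (le_trans (enormD _ _ _))// !enormZ normrN !enorm_perp.
  by rewrite lerD2r mulrC.
have h2 : enorm z0 * `|dot z1 D| <= `|dot (perp z0) z1| * enorm D + `|dot z0 D| * enorm z1.
  rewrite mulrC -(enorm_perp R z0) -enormZ -(enorm_perp R z1) -!enormZ e.
  by apply: le_trans (enormD _ _ _); rewrite subrK.
by rewrite ler_norml; lra.
Qed.

Lemma continuous_pos_bounds (R : realType) (f : R -> R) (T : R) : 0 <= T -> continuous f ->
  (forall t, 0 < f t) -> exists lo hi, [/\ 0 < lo, 0 < hi &
    forall t, t \in `[0, T] -> lo <= f t <= hi].
Proof.
move=> T0 cf f0.
have [c _ hc] := EVT_min T0 (continuous_subspaceT cf).
have [d _ hd] := EVT_max T0 (continuous_subspaceT cf).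
by exists (f c), (f d); split => // t tT; rewrite hc// hd.
Qed.

Lemma enorm_continuous (R : realType) (u : R -> 'rV[R]_2) :
  continuous u -> continuous (fun t => enorm (u t)).
Proof.
move=> cu t; apply: (@continuous_comp _ _ _ (fun t => dot (u t) (u t)) Num.sqrt).
  exact: dot_continuous.
exact: sqrt_continuous.
Qed.

Lemma perp_continuous (R : realType) (u : R -> 'rV[R]_2) :
  continuous u -> continuous (fun t => perp (u t)).
Proof.
move=> cu t; apply: (@continuous_comp _ _ _ u (@perp R)); first exact: cu.
apply: (@lipschitz_cont R _ _ _ 1) => v w; rewrite mul1r norm_rV2_le !mxE/=.
have h i := coord_le_norm R (v - w) i.
apply/andP; split; first by have := h 1; rewrite !mxE.
by rewrite -opprD normrN; have := h 0; rewrite !mxE.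
Qed.

(** Here p = <z1, D>, q = <z0, D>, m = <perp z0, z1>, b = 1 - 1/rho, while N, E1 and Dn are the
    Euclidean norms of z0, z1 and D. Cramer's rule with p close to e f / b and q close to 0 produces
    kappa = N / (|b| |m|). *)
Lemma displacement_norm_le (R : realType) (N m b e f p q Dn E1 X Y : R) :
  m != 0 -> b != 0 -> 0 <= e -> 0 <= N -> 0 <= E1 ->
  `| `|m| * Dn - N * `|p| | <= `|q| * E1 -> `|b * p - e * f| <= X -> `|q| <= Y ->
  `| e * (N / (`|b| * `|m|)) * `|f| - Dn | <= (`|b| * Y * E1 + N * X) / (`|b| * `|m|).
Proof.
move=> m0 b0 e0 N0 E10 h1 h2 h3.
have bm : 0 < `|b| * `|m| by rewrite mulr_gt0 ?normr_gt0.
have -> : e * (N / (`|b| * `|m|)) * `|f| - Dn =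
    - (`|b| * (`|m| * Dn - N * `|p|) + N * (`|b| * `|p| - e * `|f|)) / (`|b| * `|m|).
  by field; rewrite !normr_eq0 m0 b0.
rewrite normrM normfV [`|_ * _|]gtr0_norm// ler_pM2r ?invr_gt0// normrN.
rewrite (le_trans (ler_normD _ _))// !normrM normr_id (ger0_norm N0) lerD//.
  rewrite -mulrA ler_wpM2l// (le_trans h1)// ler_wpM2r//.
rewrite ler_wpM2l// (le_trans _ h2)//.
have -> : `|b| * `|p| - e * `|f| = `|b * p| - `|e * f| by rewrite !normrM (ger0_norm e0).
exact: ler_dist_dist.
Qed.

(** Since eta C3 <= 1/2, the D on the right is absorbed and D <= e (2 C4 + 1); inserting this back
    into the error makes it at most w e. *)
Lemma self_bound (R : realType) (eta C3 C4 w e D M : R) :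
  0 <= eta -> 0 < e -> 0 <= D ->
  `|e * M - D| <= eta * C3 * (D + e) -> M <= C4 -> 0 <= C3 -> 0 <= C4 ->
  eta * C3 <= 1 / 2 -> eta * C3 * (2 * C4 + 2) <= w -> `|e * M - D| <= w * e.
Proof.
move=> eta0 e0 D0 h MC C30 C40 s1 s2.
have k0 : 0 <= eta * C3 by rewrite mulr_ge0.
have eM : e * M <= e * C4 by rewrite ler_pM2l.
have hD : D <= e * (2 * C4 + 1).
  move: h; rewrite ler_norml => /andP[h _].
  have : eta * C3 * (D + e) <= 1 / 2 * (D + e) by rewrite ler_wpM2r// addr_ge0// ltW.
  lra.
apply: le_trans h _.
apply: (@le_trans _ _ (eta * C3 * (e * (2 * C4 + 2)))); first by rewrite ler_wpM2l//; lra.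
by rewrite mulrCA mulrC ler_pM2r// .
Qed.

(** Collects the errors into eta times a constant times Dn + e. The constant depends neither on e
    nor on t, as the varying norms and determinant are replaced by their extreme values. *)
Lemma displacement_error_le (R : realType) (b m mlo N Nhi Z Z1 E1 T C C' B eta e W Dn X Y : R) :
  b != 0 -> 0 < mlo -> mlo <= `|m| -> 0 <= N -> N <= Nhi -> 0 <= Z -> 0 <= Z1 -> 0 <= E1 ->
  E1 <= 2 * Z1 -> 0 <= T -> 0 <= C -> 0 <= C' -> 0 <= B -> 0 <= eta -> 0 <= e ->
  0 <= W -> W <= Dn ->
  X = 2 * Z1 * (eta * (C * (W + e * B)) + e * eta) * T ->
  Y = 2 * Z * (eta * (C' * W)) * T ->
  (`|b| * Y * E1 + N * X) / (`|b| * `|m|) <=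
  eta * ((`|b| * (2 * Z * C' * T) * (2 * Z1) + Nhi * (2 * Z1 * T * (C * (1 + B) + 1)))
    / (`|b| * mlo)) * (Dn + e).
Proof.
move=> b0 mlo0 mlom N0 NN Z0 Z10 E10 EE T0 C0 C'0 B0 eta0 e0 W0 WD -> ->.
have Dn0 : 0 <= Dn by exact: le_trans WD.
have bb : 0 < `|b| by rewrite normr_gt0.
have m0 : 0 < `|m| by exact: lt_le_trans mlom.
rewrite [leRHS](_ : _ = (eta * (`|b| * (2 * Z * C' * T) * (2 * Z1) +
  Nhi * (2 * Z1 * T * (C * (1 + B) + 1))) * (Dn + e)) / (`|b| * mlo)); last by ring.
have p1 : 0 <= 2 * Z * (eta * (C' * W)) * T by rewrite !mulr_ge0.
have p2 : 0 <= 2 * Z1 * (eta * (C * (W + e * B)) + e * eta) * T.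
  by rewrite mulr_ge0// mulr_ge0 ?mulr_ge0// addr_ge0 ?mulr_ge0// addr_ge0 ?mulr_ge0.
have h1 : `|b| * (2 * Z * (eta * (C' * W)) * T) * E1 <=
    eta * (`|b| * (2 * Z * C' * T) * (2 * Z1)) * (Dn + e).
  rewrite [leRHS](_ : _ = `|b| * (2 * Z * (eta * (C' * (Dn + e))) * T) * (2 * Z1)); last by ring.
  apply: ler_pM => //; first by rewrite mulr_ge0.
  apply: ler_wpM2l => //; apply: ler_wpM2r => //.
  do 3 ! (apply: ler_wpM2l => //; rewrite ?mulr_ge0//).
  lra.
have h2 : N * (2 * Z1 * (eta * (C * (W + e * B)) + e * eta) * T) <=
    eta * (Nhi * (2 * Z1 * T * (C * (1 + B) + 1))) * (Dn + e).
  rewrite [leRHS](_ : _ = Nhi * (2 * Z1 * (eta * (C * ((1 + B) * (Dn + e))) + (Dn + e) * eta) * T)); last by ring.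
  apply: ler_pM => //; apply: ler_wpM2r => //; apply: ler_wpM2l; first by rewrite mulr_ge0.
  apply: lerD; last by rewrite ler_wpM2r//; lra.
  do 2 apply: ler_wpM2l => //.
  have : 0 <= B * Dn by rewrite mulr_ge0.
  lra.
apply: ler_pM.
- apply: addr_ge0; last exact: mulr_ge0.
  by apply: mulr_ge0 => //; exact: mulr_ge0.
- by rewrite invr_ge0 mulr_ge0.
- by apply: le_trans (lerD h1 h2) _; rewrite -mulrDl -mulrDr.
- by rewrite lef_pV2 ?posrE ?mulr_gt0// ler_pM2l.
Qed.

Lemma phase_selection (R : realType) (psi : 'rV[R]_2 -> 'rV[R]_2)
    (x0 z0 : R -> 'rV[R]_2) (T K L Z c Bv theta0 : R) (V : 'rV[R]_2 -> R -> 'rV[R]_2)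
    (x : R -> R -> 'rV[R]_2) :
  0 < T -> 0 <= L -> (forall t, `|x0 t| <= K - 1) ->
  (forall u v, `|cutoff R psi K u - cutoff R psi K v| <= L * `|u - v|) ->
  (forall p, V p T = p) -> (forall p, solves_on setT (fun=> cutoff R psi K) (V p)) ->
  solves_on setT (fun=> psi) x0 -> periodic x0 T ->
  (forall u v : 'rV[R]_2, `|u| <= K -> `|v| <= K -> `|psi u - psi v| <= L * `|u - v|) ->
  (forall t, `|z0 t| <= Z) -> (forall t, dot (z0 t) (psi (x0 t)) = c) -> c != 0 ->
  (forall t, `|psi (x0 t)| <= Bv) ->
  (\forall e \near 0^'+, continuous (x e)) ->
  (forall m : R, 0 < m -> \forall e \near 0^'+, forall s, `|x e (s - theta0) - x0 s| <= m) ->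
  exists theta : R -> R -> R, forall m : R, 0 < m -> \forall e \near 0^'+, forall t,
    [/\ `|theta e t - theta0| <= m,
        dot (z0 t) (V (x e (t - theta e t)) 0 - x0 t) = 0 &
        forall s, `|x e (s - theta e t) - x0 s| <= m].
Proof.
move=> T0 L0 x0K lipG VT Vsol hx0 x0T lipK z0Z z0c c0 x0B hx close.
have Zp : 0 <= Z by exact: le_trans (z0Z 0).
have Bv0 : 0 <= Bv by exact: le_trans (x0B 0).
pose C' := gronwall_const R L (T + 1).
have C1' : 1 <= C' by apply: gronwall_const_ge1 => //; lra.
have C'0 : 0 <= C' by lra.
have ca : 0 < `|c| by rewrite normr_gt0.
pose A := 2 * Z * L * Bv.
have A0 : 0 <= A by rewrite /A mulr_ge0// mulr_ge0// mulr_ge0.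
have q0 : 0 < `|c| / (2 * (A + 1)) by rewrite divr_gt0//; lra.
pose delta := Num.min 1 (`|c| / (2 * (A + 1))).
have delta0 : 0 < delta by rewrite lt_min ltr01.
have delta1 : delta <= 1 by rewrite ge_min lexx.
have dsmall : 2 * Z * L * Bv * delta <= `|c| / 2.
  have : delta <= `|c| / (2 * (A + 1)) by rewrite ge_min lexx orbT.
  rewrite ler_pdivlMr; last by lra.
  by rewrite -/A; move: delta0; move: (delta) => dd; lra.
pose pd e t th := phase_defect R x0 z0 V (x e) t th.
(* The zero is selected in an interval of fixed radius delta, before the tolerance m is given, so
   one function serves all tolerances. The default theta0 is taken where no zero exists. *)
pose theta e t := xget theta0 [set th | `|th - theta0| <= delta /\ pd e t th = 0].
exists theta => m.
  move=> m0; pose A4 := 4 * Z * C' + 1.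
  have A40 : 1 <= A4 by rewrite /A4 lerDr mulr_ge0// mulr_ge0.
  (* The tolerance m is split in two: Bv mu <= m/2 for moving x0 by the phase error, and kappa <=
     m/2 for the distance of x_e. The other bound on kappa forces the phase error below mu. *)
  pose mu := Num.min delta (m / (2 * (Bv + 1))).
  have mu0 : 0 < mu by rewrite lt_min delta0 divr_gt0//; lra.
  have mud : mu <= delta by rewrite ge_min lexx.
  have mum : mu <= m / (2 * (Bv + 1)) by rewrite ge_min lexx orbT.
  rewrite ler_pdivlMr in mum; last by lra.
  pose kappa := Num.min (m / 2) (`|c| * mu / (2 * A4)).
  have kappa0 : 0 < kappa.
    by rewrite lt_min !divr_gt0//= ?mulr_gt0//; lra.
  have kappam : kappa <= m / 2 by rewrite ge_min lexx.
  have kappac : 4 * Z * C' * kappa <= `|c| * mu / 2.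
    have : kappa <= `|c| * mu / (2 * A4) by rewrite ge_min lexx orbT.
    rewrite ler_pdivlMr; last by lra.
    by rewrite /A4; move: kappa0; move: (kappa) => kk; lra.
  have cmu : 0 < `|c| * mu by rewrite mulr_gt0.
  have cmud : `|c| * mu <= `|c| * delta by rewrite ler_pM2l.
  have kl := close kappa kappa0.
  near=> e => t.
  have ke : forall s, `|x e (s - theta0) - x0 s| <= kappa by near: e.
  have cxe : continuous (x e) by near: e.
  have [th1 th2] : `|theta e t - theta0| <= delta /\ pd e t (theta e t) = 0.
    have lt4 : 4 * Z * gronwall_const R L (T + 1) * kappa < `|c| * delta by rewrite -/C'; lra.
    have [th h1 h2] := phase_defect_zero_exists R psi x0 z0 T K L V T0 L0 x0K lipG VT Vsol
      hx0 x0T Z c Bv lipK z0Z z0c x0B (x e) theta0 kappa cxe ke delta delta0 dsmall t lt4.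
    exact: (@xgetPex _ theta0 [set th | `|th - theta0| <= delta /\ pd e t th = 0]
      (ex_intro _ th (conj h1 h2))).
  have thmu : `|theta e t - theta0| <= mu.
    have := phase_defect_zero_close R psi x0 z0 T K L V T0 L0 x0K lipG VT Vsol
      hx0 x0T Z c Bv lipK z0Z z0c x0B (x e) theta0 kappa ke delta dsmall t (theta e t) th1 th2.
    rewrite -/C' => h; rewrite -(ler_pM2l ca); lra.
  have Bmu : 0 <= Bv * mu by rewrite mulr_ge0// ltW.
  split => // [|s]; first by lra.
  have -> : x e (s - theta e t) - x0 s =
      (x e ((s + (theta0 - theta e t)) - theta0) - x0 (s + (theta0 - theta e t))) +
      (x0 (s + (theta0 - theta e t)) - x0 s).
    by rewrite addrA subrK; congr (x e _ - _); ring.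
  rewrite (le_trans (ler_normD _ _))//.
  have h1 : `|x0 (s + (theta0 - theta e t)) - x0 s| <= Bv * `|theta e t - theta0|.
    have := orbit_lipschitz R psi x0 hx0 Bv x0B (s + (theta0 - theta e t)) s.
    have -> : s + (theta0 - theta e t) - s = theta0 - theta e t by ring.
    by rewrite [`|theta0 - _|]distrC.
  have := ke (s + (theta0 - theta e t)).
  have : Bv * `|theta e t - theta0| <= Bv * mu by rewrite ler_wpM2l.
  move: h1; clear -thmu kappam mum Bmu mu0 Bv0; nra.
Unshelve. all: by end_near. Qed.

Lemma displacement_uniform (R : realType) (psi : 'rV[R]_2 -> 'rV[R]_2)
    (phi : R -> 'rV[R]_2 -> R -> 'rV[R]_2) (x0 z0 z1 : R -> 'rV[R]_2)
    (T K L Z Z1 rho theta0 : R) (V : 'rV[R]_2 -> R -> 'rV[R]_2)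
    (x : R -> R -> 'rV[R]_2) (theta : R -> R -> R) :
  C1 psi ->
  {within [set p : R * 'rV[R]_2 * R | p.2 \in `[0, 1]],
    continuous (fun p => phi p.1.1 p.1.2 p.2)} ->
  0 < T -> 0 <= L -> 0 <= K -> (forall t, `|x0 t| <= K - 1) ->
  (forall u v, `|cutoff R psi K u - cutoff R psi K v| <= L * `|u - v|) ->
  (forall p, V p T = p) -> (forall p, solves_on setT (fun=> cutoff R psi K) (V p)) ->
  solves_on setT (fun=> psi) x0 -> periodic x0 T ->
  (forall u v : 'rV[R]_2, `|u| <= K -> `|v| <= K -> `|psi u - psi v| <= L * `|u - v|) ->
  (forall t, `|z0 t| <= Z) -> (forall t, - T <= t <= T -> `|z1 t| <= Z1) ->
  solves_on setT (lin (adjoint (linearization psi x0))) z0 -> periodic z0 T ->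
  solves_on setT (lin (adjoint (linearization psi x0))) z1 ->
  (forall s, z1 (s + T) = rho *: z1 s) -> rho != 0 -> rho != 1 ->
  (forall t, dot (perp (z0 t)) (z1 t) != 0) ->
  (\forall e \near 0^'+, solves_on setT (perturbed R psi phi e) (x e) /\ periodic (x e) T) ->
  (forall m : R, 0 < m -> \forall e \near 0^'+, forall t,
    [/\ `|theta e t - theta0| <= m,
        dot (z0 t) (V (x e (t - theta e t)) 0 - x0 t) = 0 &
        forall s, `|x e (s - theta e t) - x0 s| <= m]) ->
  forall w : R, 0 < w -> \forall e \near 0^'+, forall t, t \in `[0, T] ->
    `| e * (enorm (z0 t) / (`|1 - rho^-1| * `|dot (perp (z0 t)) (z1 t)|)) *
         `|f1 T phi x0 z1 theta0 t| - enorm (x e (t - theta e t) - x0 t)| <= w * e.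
Proof.
move=> hC1 cphi T0 L0 KK x0K lipG VT Vsol hx0 x0T lipK z0Z z1Z hz0 z0T hz1 z1T rho0 rho1
  m_neq0 hx good w w0.
have T0' := ltW T0.
have Zp : 0 <= Z by exact: le_trans (z0Z 0).
have Z10 : 0 <= Z1 by apply: le_trans (z1Z 0 _) => //; rewrite oppr_le0 T0'.
have cx0 : continuous x0 by exact: solution_cont hx0.
have cz0 : continuous z0 by exact: solution_cont hz0.
have cz1 : continuous z1 by exact: solution_cont hz1.
pose C := gronwall_const R L T; pose C' := gronwall_const R L (T + 1).
have C1' : 1 <= C' by apply: gronwall_const_ge1 => //; rewrite addr_ge0.
have C0 : 0 <= C by apply: le_trans (gronwall_const_ge1 R L T L0 T0').
have C'0 : 0 <= C' by apply: le_trans C1'.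
(* For t in [0, T], s in [t - T, t] and a phase within 1 of theta0, the times s - theta stay in
   [-S, S]. *)
pose S := T + `|theta0| + 1.
have S0 : 0 <= S by rewrite /S !addr_ge0.
have [[B B0 phiB] phiU] := forcing_uniform R phi S K S0 KK cphi.
pose b := 1 - rho^-1.
have b0 : b != 0.
  by rewrite subr_eq0 eq_sym; apply: contra rho1 => /eqP h; rewrite -(invrK rho) h invr1.
have [Q [hQ f1Q]] := f1_primitive R phi T theta0 x0 z1 T0 cphi cx0 cz1.
have [F F0 hF] : exists2 F, 0 <= F & forall t, t \in `[0, T] -> `|f1 T phi x0 z1 theta0 t| <= F.
  have cQ : continuous Q by move=> t; exact: derive_cont (hQ t).
  have cQT : continuous (fun t => `|Q t - Q (t - T)|).
    move=> t; apply: (@continuous_comp _ _ _ (fun t => Q t - Q (t - T)) (fun v => `|v|)).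
      apply: cvgB; first exact: cQ.
      apply: (@continuous_comp _ _ _ (fun t => t - T) Q); last exact: cQ.
      by apply: cvgB; [exact: cvg_id|exact: cvg_cst].
    exact: norm_continuous.
  have [r _ hr] := EVT_max T0' (continuous_subspaceT cQT).
  by exists `|Q r - Q (r - T)| => // t tT; rewrite f1Q; exact: hr.
pose m t := dot (perp (z0 t)) (z1 t).
have cm : continuous (fun t => `|m t|).
  move=> t; apply: (@continuous_comp _ _ _ m (fun v => `|v|)); last exact: norm_continuous.
  by apply: dot_continuous => //; exact: perp_continuous.
have [mlo [mhi [mlo0 mhi0 mb]]] := continuous_pos_bounds R _ T T0' cm
  (fun t => etrans (normr_gt0 _) (m_neq0 t)).
have bb : 0 < `|b| by rewrite normr_gt0.
pose C3 := (`|b| * (2 * Z * C' * T) * (2 * Z1) +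
  2 * Z * (2 * Z1 * T * (C * (1 + B) + 1))) / (`|b| * mlo).
have C30 : 0 <= C3.
  rewrite /C3 divr_ge0// ?mulr_ge0// ?(ltW mlo0)//.
  apply: addr_ge0; first by do ! apply: mulr_ge0 => //.
  apply: mulr_ge0; first exact: mulr_ge0.
  by apply: mulr_ge0; [do ! apply: mulr_ge0 => //|rewrite addr_ge0// mulr_ge0// addr_ge0].
(* An upper bound for kappa |f1| on [0, T]. *)
pose C4 := (2 * Z / (`|b| * mlo)) * F.
have C40 : 0 <= C4.
  by rewrite /C4 mulr_ge0// divr_ge0// ?mulr_ge0// ltW.
(* These are the two smallness conditions of [self_bound]; C3 + 1 keeps the denominators
   positive. *)
have [eta [eta0 s1 s2]] : exists eta, [/\ 0 < eta, eta * C3 <= 1 / 2 & eta * C3 * (2 * C4 + 2) <= w].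
  have p1 : 0 < 2 * (C3 + 1) by lra.
  have p2 : 0 < (C3 + 1) * (2 * C4 + 2) by rewrite mulr_gt0//; lra.
  exists (Num.min (1 / (2 * (C3 + 1))) (w / ((C3 + 1) * (2 * C4 + 2)))).
  set et := Num.min _ _.
  have et0 : 0 < et by rewrite lt_min !divr_gt0.
  have e1 : et <= 1 / (2 * (C3 + 1)) by rewrite ge_min lexx.
  have e2 : et <= w / ((C3 + 1) * (2 * C4 + 2)) by rewrite ge_min lexx orbT.
  rewrite ler_pdivlMr// in e1; rewrite ler_pdivlMr// mulrA in e2.
  clearbody et; split => //; first by clear -e1 et0; lra.
  by apply: le_trans e2; rewrite ler_wpM2r// ?ler_pM2l// ?lerDl//; lra.
have [d d0 hlin] := C1_uniform_linearization R psi K eta hC1 eta0.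
have [dphi dphi0 hphi] := phiU eta eta0.
(* The three bounds keep x_e in the ball of radius K, D in the range of the linearization estimate,
   and the arguments of phi within its modulus of continuity. *)
pose m0 := Num.min (Num.min 1 d) dphi.
have m00 : 0 < m0 by rewrite !lt_min ltr01 d0.
have m01 : m0 <= 1 by rewrite !ge_min lexx.
have m0d : m0 <= d by rewrite !ge_min lexx orbT.
have m0p : m0 <= dphi by rewrite !ge_min lexx orbT.
(* Division by 2 C' leaves room for the growth of the displacement under the backward flow. *)
pose mm := m0 / (2 * C').
have mm0 : 0 < mm by rewrite divr_gt0//; lra.
have Cmm : C' * mm = m0 / 2 by rewrite /mm; field; rewrite gt_eqF//; lra.
have mmC : mm <= C' * mm by rewrite ler_peMl// ltW.
have mm2 : mm <= m0 / 2 by rewrite -Cmm.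
have goodm := good mm mm0.
near=> e => t tT.
have e0 : 0 < e by near: e; exact: nbhs_right_gt.
have e1 : e <= 1 by near: e; apply: nbhs_right_le.
have ed : e < dphi by near: e; exact: nbhs_right_lt.
have [hxe xeT] : solves_on setT (perturbed R psi phi e) (x e) /\ periodic (x e) T by near: e.
have /(_ t)[th1 th2 th3] : forall t,
    [/\ `|theta e t - theta0| <= mm,
        dot (z0 t) (V (x e (t - theta e t)) 0 - x0 t) = 0 &
        forall s, `|x e (s - theta e t) - x0 s| <= mm] by near: e.
have tT' : 0 <= t <= T by move: tT; rewrite in_itv.
have e01 : 0 <= e <= 1 by rewrite (ltW e0).
have Dd s : `|x e (s - theta e t) - x0 s| < d.
  by apply: le_lt_trans (th3 s) _; clear -mm2 m0d m00; lra.
have D1 s : `|x e (s - theta e t) - x0 s| <= 1.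
  by apply: le_trans (th3 s) _; clear -mm2 m01 m00; lra.
have xK s : `|x e (s - theta e t)| <= K.
  rewrite -[x e _](subrK (x0 s)) (le_trans (ler_normD _ _))//.
  by have := D1 s; have := x0K s; clear; lra.
have sS s : t - T <= s <= t -> `|s - theta e t| <= S /\ `|s - theta0| <= S.
  move=> st; have h1 : `|s - theta0| <= T + `|theta0|.
    rewrite (le_trans (ler_normB _ _))// lerD2r ler_norml; clear -st tT'; lra.
  split; last by rewrite /S; clear -h1; lra.
  have -> : s - theta e t = (s - theta0) - (theta e t - theta0) by ring.
  rewrite (le_trans (ler_normB _ _))// /S lerD// (le_trans th1)//.
  by clear -mm2 m01 m00; lra.
have phiB' s : t - T <= s <= t -> `|phi (s - theta e t) (x e (s - theta e t)) e| <= B.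
  by move=> /sS[h1 _]; exact: phiB.
have x0K' s : `|x0 s| <= K by have := x0K s; clear; lra.
have phie s : t - T <= s <= t ->
    `|phi (s - theta e t) (x e (s - theta e t)) e - phi (s - theta0) (x0 s) 0| <= eta.
  move=> /sS[_ h2]; rewrite distrC ltW// hphi//.
    have -> : s - theta0 - (s - theta e t) = theta e t - theta0 by ring.
    by apply: le_lt_trans th1 _; clear -mm2 m0p m00; lra.
  by rewrite distrC; apply: le_lt_trans (th3 s) _; clear -mm2 m0p m00; lra.
have z1Z' s : t - T <= s <= t -> `|z1 s| <= Z1.
  by move=> st; apply: z1Z; clear -st tT'; lra.
have h2 := displacement_pairing_le R psi phi T rho K L B Z1 eta d e (theta e t) theta0 t x0 z1 (x e)
  T0 L0 (ltW eta0) (ltW e0) B0 hx0 x0T x0K lipK hlin hz1 z1T rho0 z1Z' cphi hxe xeT Dd D1 phiB' phie.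
set D := x e (t - theta e t) - x0 t in h2 *.
have CD : C' * `|D| <= C' * mm by rewrite ler_wpM2l// th3.
have h3 := section_pairing_le R psi x0 z0 T K L V T0 L0 x0K lipG VT Vsol hx0 x0T Z z0Z
  eta d t (x e (t - theta e t)) (ltW eta0) hlin hz0 z0T.
rewrite -/D -/C' in h3.
have {}h3 := h3 _ _ th2.
have {}h3 : `|dot (z0 t) D| <= 2 * Z * (eta * (C' * `|D|)) * T.
  by apply: h3; apply: le_lt_trans CD _ || apply: le_trans CD _; rewrite Cmm; clear -m00 m0d m01; lra.
have N0 : 0 <= enorm (z0 t) by rewrite sqrtr_ge0.
have NZ : enorm (z0 t) <= 2 * Z.
  by apply: le_trans (enorm_le _ _) _; rewrite ler_pM2l.
have E10 : 0 <= enorm (z1 t) by rewrite sqrtr_ge0.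
have EZ : enorm (z1 t) <= 2 * Z1.
  apply: le_trans (enorm_le _ _) _; rewrite ler_pM2l// z1Z'//; clear -tT' T0'; lra.
have /andP[mlom _] := mb t tT.
have h4 := displacement_norm_le R _ (m t) b e _ _ _ _ _ _ _ (m_neq0 t) b0 (ltW e0) N0 E10
  (enorm_cramer R (z0 t) (z1 t) D) h2 h3.
have h5 := displacement_error_le R b (m t) mlo (enorm (z0 t)) (2 * Z) Z Z1 (enorm (z1 t)) T C C' B
  eta e `|D| (enorm D) _ _ b0 mlo0 mlom N0 NZ Zp Z10 E10 EZ T0' C0 C'0 B0 (ltW eta0) (ltW e0)
  (normr_ge0 _) (enorm_ge _ _) erefl erefl.
have h6 := le_trans h4 h5; rewrite -/C3 -mulrA in h6; rewrite -mulrA.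
apply: (self_bound R eta C3 C4 w e (enorm D) _ (ltW eta0) e0 _ h6) => //; first exact: sqrtr_ge0.
apply: ler_pM => //; last exact: hF.
  by rewrite divr_ge0// mulr_ge0.
apply: ler_pM => //.
by rewrite lef_pV2 ?posrE ?mulr_gt0// ?ler_pM2l// normr_gt0; exact: m_neq0.
Unshelve. all: by end_near. Qed.

(** * Constants and the two-sided estimate *)

Theorem theorem1 (R : realType)
    (psi : 'rV[R]_2 -> 'rV[R]_2) (phi : R -> 'rV[R]_2 -> R -> 'rV[R]_2)
    (T : R) (x0 z0 z1 : R -> 'rV[R]_2) (rho : R)
    (theta0 : R) (x : R -> R -> 'rV[R]_2) :
  C1 psi ->
  {within [set p : R * 'rV[R]_2 * R | p.2 \in `[0, 1]],
    continuous (fun p => phi p.1.1 p.1.2 p.2)} ->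
  (forall t u e, e \in `[0, 1] -> phi (t + T) u e = phi t u e) ->
  limit_cycle psi x0 T ->
  simple_multiplier (linearization psi x0) T 1 ->
  eigenfunction (adjoint (linearization psi x0)) T 1 z0 ->
  rho != 1 ->
  eigenfunction (adjoint (linearization psi x0)) T rho z1 ->
  theta0 \in `[0, T] ->
  (\forall e \near 0^'+,
    solves_on setT (fun t u => psi u + e *: phi t u e) (x e) /\
    periodic (x e) T) ->
  (forall t, t \in `[0, T] -> x e (t - theta0) @[e --> 0^'+] --> x0 t) ->
  exists (M1 M2 e0 r0 : R) (theta o : R -> R -> R),
    [/\ [/\ 0 < M1, M1 < M2, 0 < e0, 0 < r0 & r0 <= 1],
        {uniform `[0, T], (fun e t => o e t / e) @ 0^'+ --> (fun=> 0 : R)},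
        {uniform `[0, T], theta @ 0^'+ --> (fun=> theta0)}
      & forall e t, e \in `]0, e0[ -> t \in `[0, T] ->
        e * M1 * `|f1 T phi x0 z1 theta0 t|
            <= enorm (x e (t - theta e t) - x0 t) + o e t
            <= e * M2 * `|f1 T phi x0 z1 theta0 t| /\
        (\bigcup_(r in `[- r0, r0]) Imap psi T x0 z0 t r) (x e (t - theta e t))].
Proof.
move=> hC1 cphi _ [hx0 hper _] hmult hz0 rho1 hz1 th0 hx hconv.
have [T0 x0T _] := hper.
have T0' := ltW T0.
have cx0 : continuous x0 by exact: solution_cont hx0.
have [K0 K00 x0K0] := periodic_bounded R x0 T T0 x0T cx0.
(* A margin of 1 around the cycle, so that orbits within distance 1 of it are not affected by the
   truncation. *)
pose K := K0 + 1.
have x0K t : `|x0 t| <= K - 1 by rewrite /K addrK.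
have KK : 0 <= K by rewrite /K; lra.
have x0K' t : `|x0 t| <= K by rewrite /K; have := x0K0 t; lra.
have [a a0 Ja] := C1_jacobian_bounded R psi K hC1.
have hA t i j : `|linearization psi x0 t i j| <= a by exact: Ja.
have hA' := adjoint_bounded R _ a hA.
have [c c0 z0c] := velocity_transversal R psi x0 z0 T a hC1 hx0 hper hA hmult hz0.
have [L L0 [lipG lipK [V hV]]] := cutoff_flow R psi K T hC1 KK.
have VT p := (hV p).1; have Vsol p := (hV p).2.
have m_neq0 := perp_dot_neq0 R _ a T rho z0 z1 hA' rho1 hz0 hz1.
have [hz0s _ z0T'] := hz0; have [hz1s [s1 z1s1] z1T] := hz1.
have z0T : periodic z0 T by move=> t; rewrite z0T' scale1r.
(* A zero multiplier would make z1 vanish identically. *)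
have rho0 : rho != 0.
  apply: contra z1s1 => /eqP r0; have := z1T (s1 - T).
  by rewrite subrK r0 scale0r => ->.
have cz0 : continuous z0 by exact: solution_cont hz0s.
have cz1 : continuous z1 by exact: solution_cont hz1s.
have [Z Zp z0Z] := periodic_bounded R z0 T T0 z0T cz0.
have [Bv Bv0 x0B] : exists2 Bv, 0 <= Bv & forall t, `|psi (x0 t)| <= Bv.
  apply: (periodic_bounded R (fun t => psi (x0 t)) T T0); first by move=> t; rewrite x0T.
  exact: solution_cont (velocity_solves_linearization R psi x0 hC1 hx0).
have [Z1 Z10 z1Z] : exists2 Z1, 0 <= Z1 & forall t, - T <= t <= T -> `|z1 t| <= Z1.
  have cn : continuous (fun t => `|z1 t|).
    by move=> t; apply: (@continuous_comp _ _ _ z1 (fun v => `|v|) t (cz1 t)); exact: norm_continuous.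
  have TT : - T <= T by lra.
  have [r _ hr] := EVT_max TT (continuous_subspaceT cn).
  by exists `|z1 r| => // t tT; apply: hr; rewrite in_itv.
pose S := T + `|theta0| + 1.
have S0 : 0 <= S by rewrite /S; have := normr_ge0 theta0; lra.
have [[B B0 phiB] phiU] := forcing_uniform R phi S K S0 KK cphi.
have close eta : 0 < eta -> \forall e \near 0^'+, forall s, `|x e (s - theta0) - x0 s| <= eta.
  apply: (perturbed_close R psi phi T theta0 K L B x0 x) => //.
    by move=> s u e sS; apply: phiB; rewrite /S; lra.
  by apply: hconv; rewrite in_itv/= lexx T0'.
have cx : \forall e \near 0^'+, continuous (x e).
  by apply: filterS hx => e [hxe _]; exact: solution_cont hxe.
have [theta good] := phase_selection R psi x0 z0 T K L Z c Bv theta0 V x T0 L0 x0K lipG VT Vsol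
  hx0 x0T lipK z0Z z0c c0 x0B cx close.
have z0_neq0 t : z0 t != 0.
  apply: contra (m_neq0 t) => /eqP z0t; rewrite dotE !mxE/= z0t !mxE oppr0 !mul0r addr0 //.
pose C' := gronwall_const R L (T + 1).
have C1' : 1 <= C' by apply: gronwall_const_ge1 => //; rewrite addr_ge0.
have C'0 : 0 < C' by lra.
pose b := 1 - rho^-1.
have b0 : 0 < `|b|.
  rewrite normr_gt0 subr_eq0 eq_sym; apply: contra rho1 => /eqP h.
  by rewrite -(invrK rho) h invr1.
pose m t := dot (perp (z0 t)) (z1 t).
have cm : continuous (fun t => `|m t|).
  move=> t; apply: (@continuous_comp _ _ _ m (fun v => `|v|)); last exact: norm_continuous.
  by apply: dot_continuous => //; exact: perp_continuous.
have [mlo [mhi [mlo0 mhi0 mb]]] := continuous_pos_bounds R _ T T0' cm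
  (fun t => etrans (normr_gt0 _) (m_neq0 t)).
have N_gt0 t : 0 < enorm (z0 t).
  by rewrite (lt_le_trans _ (enorm_ge _ _))// normr_gt0.
have [Nlo [Nhi [Nlo0 Nhi0 Nb]]] := continuous_pos_bounds R _ T T0' (enorm_continuous R _ cz0) N_gt0.
pose kappa t := enorm (z0 t) / (`|b| * `|m t|).
have kappab t : t \in `[0, T] -> Nlo / (`|b| * mhi) <= kappa t <= Nhi / (`|b| * mlo).
  move=> tT; have /andP[m1 m2] := mb t tT; have /andP[N1 N2] := Nb t tT.
  have mt0 : 0 < `|m t| by exact: lt_le_trans m1.
  by apply/andP; split; apply: ler_pM; rewrite ?invr_ge0 ?mulr_ge0 ?(ltW mlo0) ?(ltW mhi0) ?(ltW Nlo0) ?sqrtr_ge0//;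
    rewrite lef_pV2 ?posrE ?mulr_gt0// ler_pM2l.
have disp := displacement_uniform R psi phi x0 z0 z1 T K L Z Z1 rho theta0 V x theta hC1 cphi T0 L0 KK
  x0K lipG VT Vsol hx0 x0T lipK z0Z z1Z hz0s z0T hz1s z1T rho0 rho1 m_neq0 hx good.
pose o e t := e * kappa t * `|f1 T phi x0 z1 theta0 t| - enorm (x e (t - theta e t) - x0 t).
(* The tolerance that makes C' |D| <= 1/2, as [flow_in_Imap] requires. *)
have mm0 : 0 < 1 / (2 * C') by rewrite divr_gt0// mulr_gt0.
have mem : \forall e \near 0^'+, forall t,
    (\bigcup_(r in `[-1, 1]) Imap psi T x0 z0 t r) (x e (t - theta e t)).
  apply: filterS (good _ mm0) => e he t; have [_ h2 h3] := he t.
  apply: (flow_in_Imap R psi x0 z0 T K L V) => //.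
  have := h3 t; rewrite -(ler_pM2l C'0) => h; apply: le_trans h _.
  by rewrite le_eqVlt; apply/orP; left; apply/eqP; field; rewrite gt_eqF.
(* [e0] is the radius on which membership in the image of [Imap] holds for every t. *)
have := mem; rewrite /at_right near_withinE => /nbhs_ballP[e0 /= e00 he0].
(* The constants are the lower and upper bounds of kappa; adding 1 makes M1 < M2 strict even when
   kappa is constant. *)
exists (Nlo / (`|b| * mhi)), (Nhi / (`|b| * mlo) + 1), e0, 1, theta, o.
split.
- split => //; first by rewrite divr_gt0// mulr_gt0.
  have /andP[h1 h2] : Nlo / (`|b| * mhi) <= kappa 0 <= Nhi / (`|b| * mlo).
    by apply: kappab; rewrite in_itv/= lexx T0'.
  by clear -h1 h2; lra.
- apply: uniform_cvgP => w w0; have w20 : 0 < w / 2 by rewrite divr_gt0.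
  have hd := disp _ w20; near=> e => t tT.
  have e_gt0 : 0 < e by near: e; exact: nbhs_right_gt.
  have /(_ t tT) h : forall t, t \in `[0, T] -> `|e * kappa t * `|f1 T phi x0 z1 theta0 t| -
    enorm (x e (t - theta e t) - x0 t)| <= w / 2 * e by near: e.
  rewrite subr0 normrM normfV (gtr0_norm e_gt0) ltr_pdivrMr//.
  by apply: le_lt_trans h _; rewrite ltr_pM2r//; clear -w0; lra.
- apply: uniform_cvgP => w w0; have w20 : 0 < w / 2 by rewrite divr_gt0.
  apply: filterS (good _ w20) => e he t _; have [h _ _] := he t.
  by apply: le_lt_trans h _; clear -w0; lra.
move=> e t; rewrite in_itv/= => /andP[e_gt0 ee0] tT; split; last first.
  apply: he0 => //; rewrite -ball_normE/= sub0r normrN gtr0_norm//.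
have /andP[k1 k2] := kappab t tT.
rewrite /o addrC subrK; apply/andP; split; rewrite ler_wpM2r// ler_pM2l//.
by clear -k2; lra.
Unshelve. all: by end_near. Qed.
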